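(* Let $E$ be a complex vector bundle of rank $r$ over a (paracompact Hausdorff) topological space $B$. Suppose that for each complex line bundle $U$ on $B$, the vector bundle $E\otimes U$ is not stably trivial, i.e. $[E\otimes U]\neq[\underline{\mathbb{C}}^{r}]$ in $K^0(B)$, where $\underline{\mathbb{C}}^r$ is the trivial bundle of rank $r$. Then the projectivization $P(E)\to B$ is non-trivial as a Hamiltonian fibration, i.e. it is not isomorphic, as a fiber bundle with structure group $\mathrm{Ham}(\mathbb{CP}^{r-1},\omega)$, to the trivial bundle $B\times\mathbb{CP}^{r-1}$.
   Context: All topological spaces are paracompact Hausdorff. $K^0(B):=[B,\mathrm{Fred}(\mathcal{H})]$, the set of homotopy classes of maps to the space of Fredholm operators on a separable infinite-dimensional Hilbert space $\mathcal{H}$ (equivalently maps to $BU\times\mathbb{Z}$); a vector bundle of rank $r$ defines a class via its classifying map $B\to BU(r)\to BU\times\{r\}$. A Hamiltonian fibration with fiber a symplectic manifold $(M,\omega)$ is a fiber bundle over $B$ with fiber $M$ and structure group reduced to the group $\mathrm{Ham}(M,\omega)$ of Hamiltonian diffeomorphisms. The projectivization $P(E)$ (fiber over $b$: the space of complex lines in $E_b$) has structure group $PU(r)$, which acts on $\mathbb{CP}^{r-1}$ with the Fubini–Study form $\omega$ by Hamiltonian diffeomorphisms, so $P(E)$ is a Hamiltonian fibration with fiber $(\mathbb{CP}^{r-1},\omega)$. *)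

(* Defs.v *)
From HB Require Import structures.
From mathcomp Require Import all_boot all_order all_algebra.
From mathcomp Require Import complex.
From mathcomp Require Import all_classical all_reals all_analysis.

Set Implicit Arguments.
Unset Strict Implicit.
Unset Printing Implicit Defensive.

Import Order.TTheory GRing.Theory Num.Theory.
Import numFieldNormedType.Exports.

Local Open Scope classical_set_scope.
Local Open Scope ring_scope.
Local Open Scope sesquilinear_scope.

(* The complex numbers, typed as a numClosedFieldType so that they receive the
   norm topology of numFieldNormedType. *)
Definition Cx (R : realType) : numClosedFieldType := R[i]%C.

Definition paracompact (B : topologicalType) : Prop :=
  forall U : set (set B),
    U `<=` open -> \bigcup_(A in U) A = setT ->
  exists V : set (set B),
    [/\ V `<=` open,
        \bigcup_(A in V) A = setT,
        forall A, V A -> exists2 A', U A' & A `<=` A' &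
        forall b : B, exists2 N, nbhs b N &
          finite_set [set A | V A /\ A `&` N !=set0]].

(** * Complex vector bundles *)

(* Local frames of a family of complex vector spaces over an open cover, with
   continuous change-of-frame matrices. The total space is topologized by
   declaring the induced bijections between [at_dom i * C^r] and the part of
   the total space over [at_dom i] to be homeomorphisms. Frames are only
   meaningful on [at_dom i]. *)
Record atlas (R : realType) (B : topologicalType) (V : B -> vectType (Cx R))
    (r : nat) := Atlas {
  at_index : Type;
  at_dom : at_index -> set B;
  at_frame : at_index -> forall b, r.-tuple (V b);
  at_open : forall i, open (at_dom i);
  at_cover : forall b, exists i, at_dom i b;
  at_basis : forall i b, at_dom i b -> basis_of fullv (at_frame i b);
  at_continuous : forall i j (k l : 'I_r),
    {within at_dom i `&` at_dom j,
      continuous (fun b => coord (at_frame i b) k (at_frame j b)`_l)}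
}.

Record vbundle (R : realType) (B : topologicalType) (r : nat) := VBundle {
  vb_fiber :> B -> vectType (Cx R);
  vb_atlas : atlas vb_fiber r
}.

Section TrivialBundle.
Variables (R : realType) (B : topologicalType) (r : nat).

Definition std_frame : r.-tuple 'cV[Cx R]_r :=
  [tuple delta_mx k 0 | k < r].

Lemma std_frame_basis : basis_of fullv std_frame.
Proof.
rewrite basisEdim size_tuple dimvf dim_matrix mulr1 leqnn andbT.
apply/subvP => x _.
have sE (k : 'I_r) : std_frame`_k = delta_mx k 0 by rewrite -tnth_nth tnth_mktuple.
have -> : x = \sum_k x k 0 *: std_frame`_k.
  apply/matrixP => i j; rewrite summxE (bigD1 i) //= big1 => [|k ki].
    by rewrite sE !mxE ord1 !eqxx mulr1 addr0.
  by rewrite sE !mxE eq_sym (negPf ki) mulr0.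
apply: memv_suml => k _; apply: memvZ; apply: memv_span.
by apply: mem_nth; rewrite size_tuple.
Qed.

Definition trivial_atlas : atlas (fun _ : B => 'cV[Cx R]_r : vectType (Cx R)) r.
Proof.
exists unit (fun=> setT) (fun _ _ => std_frame).
- by move=> _; exact: openT.
- by move=> b; exists tt.
- by move=> _ b _; exact: std_frame_basis.
- by move=> _ _ k l; apply: continuous_subspaceT; exact: cst_continuous.
Defined.

Definition trivial_vbundle : vbundle R B r := VBundle trivial_atlas.
End TrivialBundle.

(* The tensor product of two finite-dimensional vector spaces, as the space of
   coordinate arrays with respect to a basis of either factor. *)
Section TensorSpace.
Variables (K : fieldType) (V W : vectType K).

Definition tensor_space : vectType K := 'M[K]_(\dim {:V}, \dim {:W}).

Definition tensor (v : V) (w : W) : tensor_space :=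
  \matrix_(i, j) (coord (vbasis {:V}) i v * coord (vbasis {:W}) j w).

Lemma tensor_suml n (c : 'I_n -> K) (x : 'I_n -> V) w :
  tensor (\sum_i c i *: x i) w = \sum_i c i *: tensor (x i) w.
Proof.
apply/matrixP => i j; rewrite summxE mxE linear_sum mulr_suml.
by apply: eq_bigr => k _; rewrite linearZ /= !mxE mulrA.
Qed.

Lemma tensorZr v a w : tensor v (a *: w) = a *: tensor v w.
Proof. by apply/matrixP => i j; rewrite !mxE linearZ /= mulrCA. Qed.

Lemma tensor0l w : tensor 0 w = 0.
Proof. by apply/matrixP => i j; rewrite !mxE linear0 mul0r. Qed.

Lemma tensor_eq0 v w : w != 0 -> tensor v w = 0 -> v = 0.
Proof.
move=> w0 vw0; case: (eqVneq v 0) => // v0.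
have nz (X : vectType K) (x : X) : x != 0 ->
    exists i, coord (vbasis {:X}) i x != 0.
  move=> x0; case: (pickP (fun i => coord (vbasis {:X}) i x != 0)) => [i|cx].
    by exists i.
  case/eqP: x0; rewrite (coord_vbasis (memvf x)) big1 // => i _.
  by move/negbFE: (cx i) => /eqP ->; rewrite scale0r.
have [i vi] := nz _ _ v0; have [j wj] := nz _ _ w0.
have /matrixP /(_ i j) := vw0; rewrite !mxE => /eqP.
by rewrite mulf_eq0 (negPf vi) (negPf wj).
Qed.

Variable r : nat.

Definition tensor_frame (x : r.-tuple V) (w : W) : r.-tuple tensor_space :=
  [tuple tensor x`_k w | k < r].

Lemma nth_tensor_frame x w (k : 'I_r) : (tensor_frame x w)`_k = tensor x`_k w.
Proof. by rewrite -tnth_nth tnth_mktuple. Qed.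

Lemma tensor_frame_basis (x : r.-tuple V) (u : 1.-tuple W) :
  basis_of fullv x -> basis_of fullv u -> basis_of fullv (tensor_frame x u`_0).
Proof.
move=> bx bu.
have u0 : u`_0 != 0.
  by apply: (basis_not0 bu); apply: mem_nth; rewrite size_tuple.
rewrite basisEfree subvf size_tuple dimvf dim_matrix.
rewrite (size_basis bx) (size_basis bu) mulr1 leqnn !andbT.
apply/freeP => c; under eq_bigr do rewrite nth_tensor_frame.
rewrite -tensor_suml => /(tensor_eq0 u0).
by have /basis_free/freeP := bx; apply.
Qed.

Lemma coord_tensor_frame (x y : r.-tuple V) (u v : 1.-tuple W) (k l : 'I_r) :
  basis_of fullv x -> basis_of fullv u ->
  coord (tensor_frame x u`_0) k (tensor_frame y v`_0)`_l =
  coord x k y`_l * coord u 0 v`_0.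
Proof.
move=> bx bu; have bt := tensor_frame_basis bx bu.
rewrite nth_tensor_frame {1}(coord_basis bx (memvf y`_l)).
rewrite {1}(coord_basis bu (memvf v`_0)) big_ord1 tensor_suml.
under eq_bigr do rewrite tensorZr scalerA -nth_tensor_frame.
exact: (coord_sum_free _ _ (basis_free bt)).
Qed.
End TensorSpace.

Section TensorBundle.
Variables (R : realType) (B : topologicalType) (r : nat).
Variables (E : vbundle R B r) (U : vbundle R B 1).

Definition tensor_atlas : atlas (fun b => tensor_space (E b) (U b)) r.
Proof.
pose AE := vb_atlas E; pose AU := vb_atlas U.
exists (at_index AE * at_index AU)%type
  (fun i => at_dom i.1 `&` at_dom i.2)
  (fun i b => tensor_frame (at_frame i.1 b) (at_frame i.2 b)`_0).
- by move=> i; apply: openI; exact: at_open.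
- move=> b; have [i ib] := at_cover AE b; have [j jb] := at_cover AU b.
  by exists (i, j).
- by move=> i b [ib jb]; apply: tensor_frame_basis; exact: at_basis.
- move=> i j k l.
  pose D : set B := at_dom i.1 `&` at_dom i.2 `&` (at_dom j.1 `&` at_dom j.2).
  pose g (b : subspace D) : Cx R :=
    coord (at_frame i.1 b) k (at_frame j.1 b)`_l *
    coord (at_frame i.2 b) 0 (at_frame j.2 b)`_0.
  apply: (@subspace_eq_continuous _ D _ g).
    move=> b; rewrite inE => -[[ib i'b] _]; apply/esym.
    by apply: coord_tensor_frame; exact: at_basis.
  move=> b; apply: continuousM.
  - have := @at_continuous _ _ _ _ AE i.1 j.1 k l.
    move/(@continuous_subspaceW _ _ D); apply.
    by move=> c [[? _] [? _]].
  - have := @at_continuous _ _ _ _ AU i.2 j.2 0 0.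
    move/(@continuous_subspaceW _ _ D); apply.
    by move=> c [[_ ?] [_ ?]].
Defined.

Definition tensor_vbundle : vbundle R B r := VBundle tensor_atlas.
End TensorBundle.

(** * K-theory *)

Record hilbert (R : realType) := Hilbert {
  hilbert_space :> completeNormedModType (Cx R);
  inner : hilbert_space -> hilbert_space -> Cx R;
  inner_linear : forall z, scalar (inner ^~ z);
  inner_conj : forall x y, inner y x = (inner x y)^*;
  inner_norm : forall x, inner x x = `|x| ^+ 2
}.

Section KTheory.
Variables (R : realType) (H : hilbert R).

Definition separable : Prop := exists x : nat -> H, dense (range x).

Definition lin_span n (e : 'I_n -> H) : set H :=
  [set x | exists c : 'I_n -> Cx R, x = \sum_k c k *: e k].

Definition infinite_dimensional : Prop :=
  ~ exists n (e : 'I_n -> H), lin_span e = setT.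

(* Bounded, with finite-dimensional kernel and cokernel. *)
Definition fredholm (T : {linear H -> H}) : Prop :=
  [/\ continuous T,
      exists n (e : 'I_n -> H), [set x | T x = 0] `<=` lin_span e &
      exists n (e : 'I_n -> H), forall y, exists x, lin_span e (y - T x)].

Definition Fred : Type := {T : {linear H -> H} | fredholm T}.

(* Uniform convergence on the unit ball is the operator norm topology. *)
Definition fred_on_ball (T : Fred) : {uniform` [set x : H | `|x| <= 1] -> H} :=
  sval T.

HB.instance Definition _ := gen_eqMixin Fred.
HB.instance Definition _ := gen_choiceMixin Fred.
HB.instance Definition _ :=
  Topological.copy Fred (initial_topology fred_on_ball).

Variable B : topologicalType.

Definition homotopic (f g : B -> Fred) : Prop :=
  exists F : B * R -> Fred,
    [/\ {within [set p | 0 <= p.2 <= 1], continuous F},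
        forall b, F (b, 0) = f b & forall b, F (b, 1) = g b].

(* [c] exhibits [b |-> range (c b)] as a classifying map of [E] into the
   Grassmannian of [r]-planes in [H], a model of BU(r): it is a fibrewise
   injective bundle map onto the tautological bundle. *)
Definition classifying (r : nat) (E : vbundle R B r)
    (c : forall b, {linear E b -> H}) : Prop :=
  (forall b, injective (c b)) /\
  forall (i : at_index (vb_atlas E)) (k : 'I_r),
    {within at_dom i, continuous (fun b => c b (at_frame i b)`_k)}.

(* The map from BU(r) to the index [r] part of [Fred] is given by the
   surjective operators with [r]-dimensional kernel: sending such an operator
   to its kernel is a homotopy equivalence onto the Grassmannian, by Kuiper's
   theorem. So a surjective family represents [E] when its kernels give a
   classifying map of [E]. *)
Definition represents (r : nat) (E : vbundle R B r) (f : B -> Fred) : Prop :=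
  [/\ continuous f,
      forall b, range (sval (f b)) = setT &
      exists c : forall b, {linear E b -> H},
        classifying c /\ forall b, range (c b) = [set x | sval (f b) x = 0]].

(* The class of [E] in the set of homotopy classes of maps [B -> Fred]; all the
   families representing [E] are homotopic when [B] is paracompact. *)
Definition K0_class (r : nat) (E : vbundle R B r) : set (B -> Fred) :=
  [set g | exists2 f, represents E f & homotopic f g].
End KTheory.
Arguments K0_class {R} H {B r} E.

(** * Projective spaces and Hamiltonian diffeomorphisms *)

(* The complex lines of a vector space. *)
Definition proj_space (K : fieldType) (V : vectType K) : Type :=
  {L : {vspace V} | \dim L == 1%N}.

Section Hamiltonian.
Variables (R : realType) (r : nat).

Notation CP := (proj_space 'cV[Cx R]_r).

(* Complex matrices as a real normed space, by real and imaginary parts. *)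
Notation reals m n := ('M[R]_(m, n) * 'M[R]_(m, n))%type.

Definition to_cplx m n (p : reals m n) : 'M[Cx R]_(m, n) :=
  \matrix_(i, j) Complex (p.1 i j) (p.2 i j).

Definition of_cplx m n (A : 'M[Cx R]_(m, n)) : reals m n :=
  (\matrix_(i, j) complex.Re (A i j), \matrix_(i, j) complex.Im (A i j)).

Definition iter_derive (V W : normedModType R) (vs : seq V) (f : V -> W) :
    V -> W :=
  foldr (fun v g => 'D_v g) f vs.

(* [f] is C^oo at the points of the open set [A]: all its iterated directional
   derivatives exist and are continuous there. *)
Definition smooth_on (V W : normedModType R) (A : set V) (f : V -> W) : Prop :=
  forall (vs : seq V) (x : V), A x ->
    {for x, continuous (iter_derive vs f)} /\
    forall v, derivable (iter_derive vs f) x v.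

(* A function on CP^(r-1) in homogeneous coordinates. Only its values on
   nonzero vectors are meaningful. As the quotient map from the nonzero
   vectors to CP^(r-1) is a submersion, a function on CP^(r-1) is smooth iff
   it is so in homogeneous coordinates. *)
Definition nonzero : set (reals r 1) := [set p | to_cplx p != 0].

Definition homog (W : zmodType) (f : CP -> W) (p : reals r 1) : W :=
  oapp f 0 (insub <[to_cplx p]>%VS).

(* A line [L] as the orthogonal projector onto [L]; this embeds CP^(r-1) in the
   Hermitian matrices. *)
Definition projector (L : CP) : 'M[Cx R]_r :=
  let z := vpick (sval L) in ((z^t* *m z) 0 0)^-1 *: (z *m z^t*).

Definition embed (L : CP) : reals r r := of_cplx (projector L).

(* The Fubini-Study form on the vectors [X], [Y] tangent to CP^(r-1) at the
   projector [P]. At the line of a unit vector [z], for [X = u z^* + z u^*] and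
   [Y = v z^* + z v^*] with [u], [v] orthogonal to [z], it is Im(u^* v). *)
Definition fubini_study (P X Y : 'M[Cx R]_r) : R :=
  complex.Im (\tr (P *m X *m Y)).

(* [phi] is the flow of the time-dependent Hamiltonian [h], i.e. of the vector
   field X with [omega (X, -) = d (h t)]. The tangent vectors at
   [phi t L = [p]] are the derivatives of [embed] along the [v]. *)
Definition hamiltonian_flow (h : R -> CP -> R) (phi : R -> CP -> CP) : Prop :=
  [/\ smooth_on [set q : R^o * reals r 1 | nonzero q.2]
        (fun q => homog (h q.1) q.2 : R^o),
      smooth_on [set q : R^o * reals r 1 | nonzero q.2]
        (fun q => homog (embed \o phi q.1) q.2),
      forall L, phi 0 L = L &
      forall (t : R) (L : CP) (p v : reals r 1), 0 <= t <= 1 ->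
        nonzero p -> sval (phi t L) = <[to_cplx p]>%VS ->
        fubini_study (projector (phi t L))
          (to_cplx (derive1 (fun s : R => embed (phi s L)) t))
          (to_cplx ('D_v (homog embed) p))
        = 'D_v (homog (h t) : reals r 1 -> R^o) p].

Definition hamiltonian_diffeo (psi : CP -> CP) : Prop :=
  exists h phi, hamiltonian_flow h phi /\ phi 1 = psi.

Definition Ham : Type := {psi : CP -> CP | hamiltonian_diffeo psi}.

(* The C^oo topology: uniform convergence, on the compact sets of nonzero
   vectors, of all the iterated derivatives in homogeneous coordinates. *)
Definition jets (psi : Ham) : prod_topology (fun vs : seq (reals r 1) =>
    {family [set A | compact A /\ A `<=` nonzero], reals r 1 -> reals r r}) :=
  fun vs => iter_derive vs (homog (embed \o sval psi)).

HB.instance Definition _ := gen_eqMixin Ham.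
HB.instance Definition _ := gen_choiceMixin Ham.
HB.instance Definition _ := Topological.copy Ham (initial_topology jets).

End Hamiltonian.

(** * Fiber bundles *)

(* Fiber bundles with fiber [F], given by local trivializations. *)
Record fbundle (B : topologicalType) (F : Type) := FBundle {
  fb_fiber :> B -> Type;
  fb_index : Type;
  fb_dom : fb_index -> set B;
  fb_chart : forall i b, fb_dom i b -> F -> fb_fiber b;
  fb_open : forall i, open (fb_dom i);
  fb_cover : forall b, exists i, fb_dom i b;
  fb_bij : forall i b (ib : fb_dom i b), bijective (fb_chart ib)
}.
Arguments fb_chart {B F} _ {i b}.

Section StructureGroup.
Variables (B : topologicalType) (F : Type).
Variables (G : topologicalType) (act : G -> F -> F).

(* In local trivializations, [f] is given by continuous maps to [G]. *)
Definition bundle_map (X Y : fbundle B F) (f : forall b, X b -> Y b) : Prop :=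
  forall (i : fb_index X) (j : fb_index Y), exists g : B -> G,
    {within fb_dom i `&` fb_dom j, continuous g} /\
    forall b (ib : fb_dom i b) (jb : fb_dom j b) (x : F),
      f b (fb_chart X ib x) = fb_chart Y jb (act (g b) x).

Definition bundle_isomorphic (X Y : fbundle B F) : Prop :=
  exists (f : forall b, X b -> Y b) (f' : forall b, Y b -> X b),
    [/\ forall b, cancel (f b) (f' b), forall b, cancel (f' b) (f b),
        bundle_map f & bundle_map f'].
End StructureGroup.

Definition trivial_fbundle (B : topologicalType) (F : Type) : fbundle B F.
Proof.
exists (fun _ : B => F) unit (fun=> setT) (fun _ _ _ x => x).
- by move=> _; exact: openT.
- by move=> b; exists tt.
- by move=> _ b _; exists id.
Defined.

(** * Projectivization *)

Section Projectivization.
Variables (K : fieldType) (r : nat) (V : vectType K) (x : r.-tuple V).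

Definition frame_map (z : 'cV[K]_r) : V := \sum_k z k 0 *: x`_k.

Fact frame_map_linear : linear frame_map.
Proof.
move=> a y z; rewrite /frame_map scaler_sumr -big_split; apply: eq_bigr => k _.
by rewrite !mxE scalerDl scalerA.
Qed.

HB.instance Definition _ :=
  GRing.isLinear.Build K 'cV[K]_r V *:%R frame_map frame_map_linear.

Definition frame_hom : 'Hom('cV[K]_r, V) := linfun frame_map.

Hypothesis bx : basis_of fullv x.

Lemma frame_hom_ker : lker frame_hom == 0%VS.
Proof.
apply/lker0P => y z; rewrite !lfunE /= => yz; apply/matrixP => k j.
rewrite ord1 -[LHS](coord_sum_free (y ^~ 0) k (basis_free bx)).
rewrite -[RHS](coord_sum_free (z ^~ 0) k (basis_free bx)); congr (coord _ _ _).
exact: yz.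
Qed.

Lemma frame_hom_lim : limg frame_hom = fullv.
Proof.
apply/eqP; rewrite eqEdim subvf limg_dim_eq ?(eqP frame_hom_ker) ?capv0 //.
by rewrite (size_basis bx) dimvf dim_matrix mulr1 leqnn.
Qed.

Fact frame_line_subproof (L : proj_space 'cV[K]_r) :
  \dim (frame_hom @: sval L) == 1%N.
Proof. by rewrite limg_dim_eq ?(eqP frame_hom_ker) ?capv0 // (svalP L). Qed.

Definition frame_line (L : proj_space 'cV[K]_r) : proj_space V :=
  exist _ (frame_hom @: sval L)%VS (frame_line_subproof L).

Lemma frame_line_bij : bijective frame_line.
Proof.
have dim_pre (M : proj_space V) : \dim (frame_hom @^-1: sval M) == 1%N.
  suff -> : \dim (frame_hom @^-1: sval M) = \dim (sval M) by rewrite (svalP M).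
  rewrite -[in RHS](@lpreimK _ _ _ frame_hom (sval M)).
    by rewrite limg_dim_eq // (eqP frame_hom_ker) capv0.
  by rewrite frame_hom_lim subvf.
pose pre (M : proj_space V) : proj_space 'cV[K]_r :=
  @exist _ (fun L : {vspace _} => \dim L == 1%N) _ (dim_pre M).
exists pre.
  move=> L; apply/val_inj => /=; apply/eqP.
  rewrite -(eq_limg_ker0 _ _ frame_hom_ker) lpreimK //.
  by rewrite frame_hom_lim subvf.
by move=> M; apply/val_inj => /=; rewrite lpreimK // frame_hom_lim subvf.
Qed.
End Projectivization.

Section ProjectiveBundle.
Variables (R : realType) (B : topologicalType) (r : nat) (E : vbundle R B r).

(* A reduction of the structure group of [E] from GL(r) to U(r), i.e. local
   frames that are orthonormal for a Hermitian metric on [E]. Over a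
   paracompact Hausdorff base one exists and is unique up to isomorphism. *)
Record unitary_reduction := UnitaryReduction {
  ur_atlas :> atlas E r;
  ur_compatible : forall (i : at_index (vb_atlas E)) (j : at_index ur_atlas)
      (k l : 'I_r),
    {within at_dom i `&` at_dom j,
      continuous (fun b => coord (at_frame i b) k (at_frame j b)`_l)};
  ur_unitary : forall (i j : at_index ur_atlas) b,
    at_dom i b -> at_dom j b ->
    (\matrix_(k < r, l < r) coord (at_frame i b) k (at_frame j b)`_l)
      \is unitarymx
}.

(* P(E), with the local trivializations given by the unitary local frames, so
   that its transition functions are in PU(r), a subgroup of Ham. The fiber
   over [b] is the space of complex lines of [E b]. *)
Definition projectivization (Q : unitary_reduction) :
  fbundle B (proj_space 'cV[Cx R]_r).
Proof.
exists (fun b => proj_space (E b)) (at_index Q) (@at_dom _ _ _ _ Q)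
  (fun i b ib => frame_line (at_basis ib)).
- exact: at_open.
- exact: at_cover.
- by move=> i b ib; exact: frame_line_bij.
Defined.
End ProjectiveBundle.

(* Isomorphism of bundles with fiber CP^(r-1) and structure group
   Ham(CP^(r-1), omega). *)
Definition ham_isomorphic (R : realType) (B : topologicalType) (r : nat)
    (X Y : fbundle B (proj_space 'cV[Cx R]_r)) : Prop :=
  @bundle_isomorphic _ _ (Ham R r) (fun psi => sval psi) X Y.

(* Main.v *)
(* A Hamiltonian diffeomorphism psi of CP^(r-1) moves a base point x0 and, being
   symplectic, has an injective complex-linear part of its derivative there; so
   psi(x0) = [z] together with the complex-linear derivative at x0 gives a basis
   of Hom([z], C^r), which depends continuously on psi and is equivariant for
   the unitary group acting by postcomposition. An isomorphism from the trivial
   Ham-bundle to P(E) thus provides a line subbundle L of E (the image of x0)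
   and a global frame of Hom(L, E). With U dual to L, the bundle E (x) U is
   trivial, not only stably, hence has the K-theory class of the trivial bundle.
   Invariance of the symplectic form under a flow phi_t with Hamiltonian h_t:
   omega(dphi_t/dt, -) pulls back to d(h_t o phi_t), and equality of the mixed
   second derivatives of h_t o phi_t is the vanishing of the time derivative of
   phi_t^* omega, because traces of products of three matrices anticommuting
   with the reflection 2P - 1 vanish. *)
Require Import Defs.
From HB Require Import structures.
From mathcomp Require Import all_boot all_order all_algebra.
From mathcomp Require Import complex.
From mathcomp Require Import all_classical all_reals all_analysis.
From mathcomp Require Import ring.

Set Implicit Arguments.
Unset Strict Implicit.
Unset Printing Implicit Defensive.

Import Order.TTheory GRing.Theory Num.Theory.
Import numFieldNormedType.Exports.

Local Open Scope classical_set_scope.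
Local Open Scope ring_scope.
Local Open Scope sesquilinear_scope.

(** * Mean values and mixed derivatives *)

(** The unit vector [e b] spanning the image of x0 is picked point by point, so its phase may jump
    with [b]. Continuity is available only for products of a vector linear in [z b] with a conjugate
    coordinate of [z b], and the construction keeps to such products: the line bundle has constant
    fiber C, its frames are inverses of conjugate coordinates of [z b], and the phases cancel in the
    tensor product. The basis of Hom([z], C^r) reflects the Euler sequence Hom(L, C^r) = Hom(L, L) +
    T: the projector onto [z] accounts for the first summand and the r - 1 complex tangent
    directions at x0 for the second. Independence comes from the positivity of omega(dpsi v, dpsi (i
    v)), which symplecticity carries over from x0. [smooth_on] speaks only of directional
    derivatives. Their linearity in the direction, the chain rule along a curve and the symmetry of
    mixed derivatives are therefore all derived from one-dimensional mean values. *)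

Section DirectionalDerivatives.
Variable R : realType.
Implicit Types V W : normedModType R.

Lemma cvg_is_derive V W (f : V -> W) (x v : V) (df : W) :
  (fun h : R => h^-1 *: ((f \o shift x) (h *: v) - f x)) @ 0^' --> df ->
  is_derive x v f df.
Proof. by move=> E; split; [apply/cvg_ex; exists df | exact/cvg_lim]. Qed.

Lemma is_derive_line V W (f : V -> W) (x v : V) (s : R) df :
  is_derive (x + s *: v) v f df <->
  is_derive s 1 (fun s : R => f (x + s *: v)) df.
Proof.
have E : (fun h : R => h^-1 *: ((f \o shift (x + s *: v)) (h *: v)
              - f (x + s *: v))) =
   (fun h : R => h^-1 *: (((fun s : R => f (x + s *: v)) \o shift s) (h *: 1)
              - f (x + s *: v))).
  apply/funext => h /=.
  rewrite addrCA -scalerDl; congr (_ *: (f (_ + _ *: _) - _)).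
  by rewrite /GRing.scale /= mulr1.
split=> -[d1 d2]; apply: DeriveDef; move: d1 d2; rewrite /derivable /derive E //.
Qed.

Lemma is_derive_translate V W (f : V -> W) (a x v : V) df :
  is_derive (x + a) v f df <-> is_derive x v (fun y => f (y + a)) df.
Proof.
have E : (fun h : R => h^-1 *: ((f \o shift (x + a)) (h *: v) - f (x + a))) =
   (fun h : R => h^-1 *: (((fun y => f (y + a)) \o shift x) (h *: v)
              - f (x + a))).
  by apply/funext => h /=; rewrite addrA.
split=> -[d1 d2]; apply: DeriveDef; move: d1 d2; rewrite /derivable /derive E //.
Qed.

End DirectionalDerivatives.

Section MeanValue.
Variables (R : realType) (V : normedModType R).
Implicit Types (f : V -> R) (x u v : V).

(** The parameter runs over [0, 1] and is scaled by [t], so that [t] may have either sign. *)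
Lemma mean_value_segment f (df : V -> R) x v (t : R) :
  (forall s : R, 0 <= s <= 1 ->
    is_derive (x + (s * t) *: v) v f (df (x + (s * t) *: v))) ->
  exists2 s : R, 0 <= s <= 1 &
    f (x + t *: v) - f x = t * df (x + (s * t) *: v).
Proof.
move=> dfx.
have dg (s : R) : 0 <= s <= 1 -> is_derive s 1 (fun s : R => f (x + (s * t) *: v))
    (t * df (x + (s * t) *: v)).
  move=> s01; have /is_derive_line h := dfx s s01.
  have ds : is_derive s (1 : R) (fun s : R => s * t) t.
    apply: (@is_derive_eq _ _ _ _ _ _ _ _ (is_deriveM _ _)).
    by rewrite scaler0 add0r /GRing.scale /= mulr1.
  have := @is_derive1_comp R (fun s : R => f (x + s *: v)) (fun s => s * t) s
    (df (x + (s * t) *: v)) t h ds.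
  by rewrite [t * _]mulrC.
have [||s s01] := @MVT_segment R (fun s => f (x + (s * t) *: v))
    (fun s => t * df (x + (s * t) *: v)) 0 1 ler01.
- by move=> s; rewrite in_itv /= => /andP[a b]; apply: dg; rewrite !ltW.
- apply: derivable_within_continuous => s; rewrite in_itv /= => /dg.
  by move=> [].
rewrite mul1r mul0r scale0r addr0 subr0 mulr1 => E.
by exists s => //; move: s01; rewrite in_itv.
Qed.

(** Two mean values: the increment of [f] in the direction [v], as a function of the position, is
    estimated along [u], and then [g] along [v]. The second difference becomes [h ^+ 2] times a
    value of [k] near [x]. *)
Lemma mixed_difference f (g k : V -> R) (A : set V) x u v (e : R) :
  nbhs x A -> (forall y, A y -> is_derive y u f (g y)) ->
  (forall y, A y -> is_derive y v g (k y)) ->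
  {for x, continuous k} -> 0 < e ->
  exists2 d, 0 < d & forall h, 0 < h < d ->
    `|(f (x + h *: v + h *: u) - f (x + h *: v) - (f (x + h *: u) - f x))
      / h ^+ 2 - k x| <= e.
Proof.
move=> nA du dvu cvu e0.
have : nbhs x (A `&` [set y | `|k x - k y| <= e]).
  by apply: filterI => //; move/cvgrPdist_le : cvu; apply.
move=> /nbhs_normP[r /= r0 Br].
(* Keeps the parallelogram spanned by [h *: u] and [h *: v] inside the ball of radius [r]; the
   summand 1 guards against u = v = 0. *)
exists (r / (`|u| + `|v| + 1)) => [|h /andP[h0 hr]].
  by rewrite divr_gt0 // ltr_wpDl.
have B (s t : R) : 0 <= s <= 1 -> 0 <= t <= 1 ->
    ball_ Num.norm x r (x + (s * h) *: u + (t * h) *: v).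
  move=> /andP[s0 s1] /andP[t0 t1]; rewrite /ball_ /=.
  rewrite -addrA opprD addNKr normrN.
  apply: (@le_lt_trans _ _ (h * (`|u| + `|v|))).
    apply: (le_trans (ler_normD _ _)); rewrite mulrDr !normrZ !ger0_norm ?mulr_ge0 ?(ltW h0) //.
    by rewrite lerD // ler_wpM2r // ler_piMl // ltW.
  apply: (@le_lt_trans _ _ (h * (`|u| + `|v| + 1))).
    by rewrite ler_wpM2l ?(ltW h0) // lerDl.
  by rewrite -ltr_pdivlMr // ltr_wpDl.
pose a y := f (y + h *: v) - f y.
have da y : A y -> A (y + h *: v) -> is_derive y u a (g (y + h *: v) - g y).
  move=> d1 d2; apply: is_deriveB; last exact: du.
  have [H _] := is_derive_translate f (h *: v) y u (g (y + h *: v)).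
  by apply: H; exact: du.
have h01 : (0 <= (1 : R) <= 1) by rewrite ler01 lexx.
have h00 : (0 <= (0 : R) <= 1) by rewrite ler01 lexx.
have ad (s : R) : 0 <= s <= 1 -> is_derive (x + (s * h) *: u) u a
    (g (x + (s * h) *: u + h *: v) - g (x + (s * h) *: u)).
  move=> s01; apply: da.
    by have [] := Br _ (B s 0 s01 h00); rewrite mul0r scale0r addr0.
  by have [] := Br _ (B s 1 s01 h01); rewrite mul1r.
have [s s01 Es] := @mean_value_segment a (fun y => g (y + h *: v) - g y) x u h ad.
have [t t01 Et] := @mean_value_segment g k (x + (s * h) *: u) v h
   (fun t t01 => dvu _ (Br _ (B s t s01 t01)).1).
have Bst : `|k x - k (x + (s * h) *: u + (t * h) *: v)| <= e.
  exact: (Br _ (B s t s01 t01)).2.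
rewrite distrC in Bst; move: Bst.
suff -> : f (x + h *: v + h *: u) - f (x + h *: v) - (f (x + h *: u) - f x)
   = h ^+ 2 * k (x + (s * h) *: u + (t * h) *: v).
  by rewrite [h ^+ 2 * _]mulrC mulfK // expf_neq0 // gt_eqF.
rewrite expr2 -mulrA -Et -Es /a.
rewrite (addrAC x (h *: v)); move: (f _) (f _) (f _) (f _) => a1 a2 a3 a4; ring.
Qed.

(** Schwarz's theorem: the second difference is symmetric in [u] and [v], and for small [h] its
    quotient by [h ^+ 2] is within [e / 2] of each mixed derivative. *)
Lemma derive_swap f (fu fv fuv fvu : V -> R) (A : set V) x u v :
  nbhs x A ->
  (forall y, A y -> is_derive y u f (fu y)) ->
  (forall y, A y -> is_derive y v f (fv y)) ->
  (forall y, A y -> is_derive y v fu (fvu y)) ->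
  (forall y, A y -> is_derive y u fv (fuv y)) ->
  {for x, continuous fvu} -> {for x, continuous fuv} -> fvu x = fuv x.
Proof.
move=> nA du dv dvu duv cvu cuv; apply/eqP; rewrite -subr_eq0 -normr_le0.
apply/ler_addgt0Pr => e e0; rewrite add0r.
have e20 : 0 < e / 2 by rewrite divr_gt0.
have [d1 d10 H1] := mixed_difference nA du dvu cvu e20.
have [d2 d20 H2] := mixed_difference nA dv duv cuv e20.
pose h := Num.min d1 d2 / 2.
have m0 : 0 < Num.min d1 d2 by rewrite lt_min d10.
have hm : h < Num.min d1 d2 by rewrite /h ltr_pdivrMr // ltr_pMr // ltr1n.
have h0 : 0 < h by rewrite divr_gt0.
move: hm; rewrite lt_min => /andP[hd1 hd2].
have := H1 h; have := H2 h; rewrite h0 hd1 hd2 => /(_ isT) a2 /(_ isT) a1.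
move: a1 a2; rewrite (addrAC x (h *: v)).
move: (fvu x) (fuv x) => p q.
move: (f (x + h *: u + h *: v)) (f (x + h *: v)) (f (x + h *: u)) (f x) => b1 b2 b3 b4.
have -> : b1 - b3 - (b2 - b4) = b1 - b2 - (b3 - b4) by ring.
move: ((b1 - b2 - (b3 - b4)) / h ^+ 2) => D a1 a2.
rewrite (splitr e) -(subrKA D) (le_trans (ler_normD _ _)) //.
by rewrite lerD // distrC.
Qed.

(* Increments along finitely many directions are added one at a time, so only
   one-directional mean values are needed. *)
Lemma is_derive_increment f (df : V -> R) (A : set V) (c : R -> V) (k : R -> R)
    x e l dk :
  nbhs x A -> (forall y, A y -> is_derive y e f (df y)) ->
  {for x, continuous df} ->
  c 0 = x -> {for (0 : R), continuous c} -> k 0 = 0 ->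
  is_derive (0 : R) (1 : R) k dk ->
  is_derive (0 : R) (1 : R) (f \o c) l ->
  is_derive (0 : R) (1 : R) (fun s => f (c s + k s *: e)) (l + dk * df x).
Proof.
move=> nA de ce c0 cc k0 dk0 dfc.
(* The difference quotient, completed by its limit where [k s] vanishes. The factorization [qE] then
   holds for every [s], and the derivative of [k * q] at a zero of [k] only asks that [q] be
   continuous there. *)
pose q s := if k s == 0 then df x else (f (c s + k s *: e) - f (c s)) / k s.
have qE s : f (c s + k s *: e) = f (c s) + k s * q s.
  rewrite /q; case: ifP => [/eqP -> | /negbT n0].
    by rewrite scale0r addr0 mul0r addr0.
  by rewrite mulrC divfK // subrKC.
have kc : {for (0 : R), continuous k}.
  by apply/differentiable_continuous/derivable1_diffP; case: dk0.
have q0 : q s @[s --> 0] --> df x.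
  apply/cvgrPdist_le => eps eps0.
  have : nbhs x (A `&` [set y | `|df x - df y| <= eps]).
    by apply: filterI => //; move/cvgrPdist_le : ce; apply.
  move=> /nbhs_normP[r /= r0 Br].
  have c1 : \forall s \near (0:R), `|x - c s| < r / 2.
    move: cc; rewrite /prop_for /continuous_at c0 => /cvgrPdist_lt; apply.
    by rewrite divr_gt0.
  have k1 : \forall s \near (0:R), `|k s| < r / 2 / (`|e| + 1).
    move: kc; rewrite /prop_for /continuous_at k0 => /cvgrPdist_lt.
    move/(_ (r / 2 / (`|e| + 1))); rewrite !divr_gt0 ?ltr_wpDl // => /(_ isT).
    by apply: filterS => s; rewrite sub0r normrN.
  near=> s.
  rewrite /q; case: ifP => [_|/negbT n0]; first by rewrite subrr normr0 ltW.
  have B (t : R) : 0 <= t <= 1 -> ball_ Num.norm x r (c s + (t * k s) *: e).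
    move=> /andP[t0 t1]; rewrite /ball_ /= opprD addrA (splitr r).
    apply: (le_lt_trans (ler_normB _ _)); rewrite ltrD //.
      by near: s; exact: c1.
    rewrite normrZ normrM ger0_norm //.
    apply: (@le_lt_trans _ _ (`|k s| * (`|e| + 1))).
      rewrite -mulrA; apply: (@le_trans _ _ (`|k s| * `|e|)).
        by rewrite ler_piMl // mulr_ge0.
      by rewrite ler_wpM2l // lerDl.
    rewrite -ltr_pdivlMr ?ltr_wpDl //.
    by near: s; exact: k1.
  have [t t01 ->] := @mean_value_segment f df (c s) e (k s)
     (fun t t01 => de _ (Br _ (B t t01)).1).
  rewrite [k s * _]mulrC mulfK //.
  exact: (Br _ (B t t01)).2.
under eq_fun do rewrite qE.
apply: is_deriveD => //.
have E : (h^-1 *: (((fun s => k s * q s) \o shift 0) (h *: 1) - k 0 * q 0))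
    @[h --> 0^'] --> dk * df x.
  under eq_fun => h.
    rewrite /= addr0 k0 mul0r subr0 [h *: 1]mulr1 [_ *: _]mulrA.
    over.
  apply: cvgM; last exact: cvg_within_filter q0.
  case: dk0 => + <-; rewrite /derivable /derive => H.
  have -> : (fun h => h^-1 * k h) =
     (fun h => h^-1 *: ((k \o shift 0) (h *: 1) - k 0)) => //.
  by apply/funext => h /=; rewrite addr0 k0 subr0 [h *: 1]mulr1.
exact: cvg_is_derive E.
Unshelve. all: by end_near. Qed.

End MeanValue.

(** * Chain rules and complex-valued curves *)

Section Curves.
Variables (R : realType) (V : normedModType R).

Lemma is_derive_increments (f : V -> R) (df : V -> V -> R) (A : set V) x
    (I : Type) (s : seq I) (e : I -> V) (k : I -> R -> R) (dk : I -> R) :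
  nbhs x A -> (forall y v, A y -> is_derive y v f (df v y)) ->
  (forall v, {for x, continuous (df v)}) ->
  (forall i, k i 0 = 0) -> (forall i, is_derive (0 : R) (1 : R) (k i) (dk i)) ->
  is_derive (0 : R) (1 : R) (fun h => f (x + \sum_(i <- s) k i h *: e i))
    (\sum_(i <- s) dk i * df (e i) x).
Proof.
move=> nA dfA cf k0 dk0.
have kc i : {for 0, continuous (k i)}.
  by apply/differentiable_continuous/derivable1_diffP; case: (dk0 i).
elim: s => [|i s IH].
  rewrite big_nil; under eq_fun do rewrite big_nil; exact: is_derive_cst.
rewrite big_cons addrC; under eq_fun do rewrite big_cons addrCA addrC.
apply: (@is_derive_increment _ _ _ (df (e i)) A) => //.
- by rewrite big1 ?addr0 // => j _; rewrite k0 scale0r.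
- apply: cvgD; first exact: cvg_cst.
  elim: s {IH} => [|j s IH].
    by under eq_fun do rewrite big_nil; rewrite big_nil; exact: cvg_cst.
  under eq_fun do rewrite big_cons; rewrite big_cons.
  by apply: cvgD => //; apply: cvgZ; [exact: kc | exact: cvg_cst].
Qed.

(** Linearity in the direction: the curve h -> x + h * sum is differentiated once as a line and once
    as a sum of increments [h * c i] along the [e i]. *)
Lemma derive_sum_dir (f : V -> R) (df : V -> V -> R) (A : set V) x (I : Type)
    (s : seq I) (e : I -> V) (c : I -> R) :
  nbhs x A -> (forall y v, A y -> is_derive y v f (df v y)) ->
  (forall v, {for x, continuous (df v)}) ->
  df (\sum_(i <- s) c i *: e i) x = \sum_(i <- s) c i * df (e i) x.
Proof.
move=> nA dfA cf.
have lin i : is_derive (0 : R) (1 : R) (fun h => h * c i) (c i).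
  apply: (@is_derive_eq _ _ _ _ _ _ _ _ (is_deriveM _ _)).
  by rewrite scaler0 add0r /GRing.scale /= mulr1.
have := @is_derive_increments f df A x I s e (fun i h => h * c i) c nA dfA cf
  (fun i => mul0r (c i)) lin.
have -> : (fun h => f (x + \sum_(i <- s) (h * c i) *: e i)) =
   (fun h => f (x + h *: \sum_(i <- s) c i *: e i)).
  apply/funext => h; rewrite scaler_sumr; congr (f (_ + _)).
  by apply: eq_bigr => i _; rewrite scalerA.
move=> /is_derive_line; rewrite scale0r addr0 => -[_ <-].
by have [_ ->] := dfA x (\sum_(i <- s) c i *: e i) (nbhs_singleton nA).
Qed.

Lemma is_derive_curve (f : V -> R) (df : V -> V -> R) (A : set V) x (I : Type)
    (s : seq I) (e : I -> V) (k : I -> R -> R) (dk : I -> R) :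
  nbhs x A -> (forall y v, A y -> is_derive y v f (df v y)) ->
  (forall v, {for x, continuous (df v)}) ->
  (forall i, is_derive (0 : R) (1 : R) (k i) (dk i)) ->
  is_derive (0 : R) (1 : R)
    (fun h => f (x + \sum_(i <- s) (k i h - k i 0) *: e i))
    (df (\sum_(i <- s) dk i *: e i) x).
Proof.
move=> nA dfA cf dk0; rewrite (derive_sum_dir _ _ _ nA dfA) //.
apply: (@is_derive_increments _ _ A _ _ _ _ (fun i h => k i h - k i 0)) => //.
  by move=> i; rewrite subrr.
move=> i; apply: (@is_derive_eq _ _ _ _ _ _ _ _ (is_deriveB (dk0 i) (is_derive_cst _ _ _))).
by rewrite subr0.
Qed.

End Curves.

Local Notation reals R m n := ('M[R]_(m, n) * 'M[R]_(m, n))%type.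

Section ComplexDerivative.
Variable R : realType.
Implicit Types (z w : R -> Cx R) (s : R).

(** Derivative in a real variable, taken part by part because the norm on [Cx R] takes its values in
    [Cx R]. *)
Definition is_cderive z s (dz : Cx R) : Prop :=
  is_derive s (1 : R) (fun t => complex.Re (z t)) (complex.Re dz) /\
  is_derive s (1 : R) (fun t => complex.Im (z t)) (complex.Im dz).

Lemma cReD (x y : Cx R) : complex.Re (x + y) = complex.Re x + complex.Re y.
Proof. by case: x y => a b [c d]. Qed.
Lemma cImD (x y : Cx R) : complex.Im (x + y) = complex.Im x + complex.Im y.
Proof. by case: x y => a b [c d]. Qed.
Lemma cReM (x y : Cx R) : complex.Re (x * y) =
  complex.Re x * complex.Re y - complex.Im x * complex.Im y.
Proof. by case: x y => a b [c d]. Qed.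
Lemma cImM (x y : Cx R) : complex.Im (x * y) =
  complex.Re x * complex.Im y + complex.Im x * complex.Re y.
Proof. by case: x y => a b [c d]. Qed.

Lemma cReIm_inj (x y : Cx R) :
  complex.Re x = complex.Re y -> complex.Im x = complex.Im y -> x = y.
Proof. by case: x y => a b [c d] /= -> ->. Qed.

Lemma is_cderive_cst (c : Cx R) s : is_cderive (fun=> c) s 0.
Proof. by split; exact: is_derive_cst. Qed.

Lemma is_cderiveD z w s dz dw : is_cderive z s dz -> is_cderive w s dw ->
  is_cderive (fun t => z t + w t) s (dz + dw).
Proof.
move=> [z1 z2] [w1 w2]; split.
  by under eq_fun do rewrite cReD; rewrite cReD; apply: is_deriveD.
by under eq_fun do rewrite cImD; rewrite cImD; apply: is_deriveD.
Qed.

Lemma is_cderiveM z w s dz dw : is_cderive z s dz -> is_cderive w s dw ->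
  is_cderive (fun t => z t * w t) s (dz * w s + z s * dw).
Proof.
move=> [z1 z2] [w1 w2]; split.
  under eq_fun do rewrite cReM.
  apply: (@is_derive_eq _ _ _ _ _ _ _ _
     (is_deriveB (is_deriveM z1 w1) (is_deriveM z2 w2))).
  by rewrite cReD !cReM /GRing.scale /=; ring.
under eq_fun do rewrite cImM.
apply: (@is_derive_eq _ _ _ _ _ _ _ _
   (is_deriveD (is_deriveM z1 w2) (is_deriveM z2 w1))).
by rewrite cImD !cImM /GRing.scale /=; ring.
Qed.

Lemma is_cderive_sum (I : Type) (r : seq I) (z : I -> R -> Cx R) s dz :
  (forall i, is_cderive (z i) s (dz i)) ->
  is_cderive (fun t => \sum_(i <- r) z i t) s (\sum_(i <- r) dz i).
Proof.
move=> dzi; elim: r => [|i r IH].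
  by rewrite big_nil; under eq_fun do rewrite big_nil; exact: is_cderive_cst.
by rewrite big_cons; under eq_fun do rewrite big_cons; exact: is_cderiveD.
Qed.

Lemma is_cderive_unique z s dz dz' :
  is_cderive z s dz -> is_cderive z s dz' -> dz = dz'.
Proof. by move=> [[_ a] [_ b]] [[_ c] [_ d]]; apply: cReIm_inj; congruence. Qed.

Lemma near_is_cderive z w s dz : (\near s, z s = w s) ->
  is_cderive z s dz -> is_cderive w s dz.
Proof.
by move=> zw [a b]; split; [apply: near_eq_is_derive a | apply: near_eq_is_derive b];
  apply: filterS zw => t ->.
Qed.

Definition is_mderive m n (X : R -> 'M[Cx R]_(m, n)) s (dX : 'M[Cx R]_(m, n)) : Prop :=
  forall i j, is_cderive (fun t => X t i j) s (dX i j).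

Lemma is_mderive_cst m n (C : 'M[Cx R]_(m, n)) s : is_mderive (fun=> C) s 0.
Proof. by move=> i j; rewrite mxE; exact: is_cderive_cst. Qed.

Lemma is_mderiveM m n p (X : R -> 'M[Cx R]_(m, n)) (Y : R -> 'M[Cx R]_(n, p)) s dX dY :
  is_mderive X s dX -> is_mderive Y s dY ->
  is_mderive (fun t => X t *m Y t) s (dX *m Y s + X s *m dY).
Proof.
move=> dx dy i j; rewrite !mxE -big_split; under eq_fun do rewrite mxE.
by apply: is_cderive_sum => k; exact: is_cderiveM.
Qed.

Lemma is_mderive_unique m n (X : R -> 'M[Cx R]_(m, n)) s dX dX' :
  is_mderive X s dX -> is_mderive X s dX' -> dX = dX'.
Proof.
by move=> a b; apply/matrixP => i j; exact: is_cderive_unique (a i j) (b i j).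
Qed.

Lemma near_is_mderive m n (X Y : R -> 'M[Cx R]_(m, n)) s dX :
  (\near s, X s = Y s) -> is_mderive X s dX -> is_mderive Y s dX.
Proof.
move=> XY dx i j; apply: near_is_cderive (dx i j).
by apply: filterS XY => t ->.
Qed.

Lemma is_mderive_trace n (X : R -> 'M[Cx R]_n) s dX :
  is_mderive X s dX -> is_cderive (fun t => \tr (X t)) s (\tr dX).
Proof. by move=> dx; apply: is_cderive_sum. Qed.

Lemma to_cplx_re m n (p : reals R m n) i j : complex.Re (to_cplx p i j) = p.1 i j.
Proof. by rewrite mxE. Qed.
Lemma to_cplx_im m n (p : reals R m n) i j : complex.Im (to_cplx p i j) = p.2 i j.
Proof. by rewrite mxE. Qed.

Lemma is_derive_entries (V : normedModType R) m n (f : V -> reals R m n) x v df :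
  is_derive x v f df <->
  forall i j, is_derive x v (fun y => (f y).1 i j) (df.1 i j) /\
              is_derive x v (fun y => (f y).2 i j) (df.2 i j).
Proof.
have cvgE (g : R -> reals R m n) (l : reals R m n) :
    g @ 0^' --> l <-> forall i j, (fun h => (g h).1 i j) @ 0^' --> l.1 i j /\
      (fun h => (g h).2 i j) @ 0^' --> l.2 i j.
  split=> [gl i j|H].
    have a : (fun h => (g h).1) @ 0^' --> l.1 by exact: (cvg_comp _ _ gl cvg_fst).
    have b : (fun h => (g h).2) @ 0^' --> l.2 by exact: (cvg_comp _ _ gl cvg_snd).
    have cij := @coord_continuous R m n i j.
    split; [exact: (cvg_comp _ _ a (cij _)) | exact: (cvg_comp _ _ b (cij _))].
  have c1 : (fun h => (g h).1) @ 0^' --> l.1.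
    apply/cvgrPdist_le => e e0; near=> h.
    rewrite /Num.Def.normr/= mx_normrE (bigmax_le _ (ltW e0))//= => i _.
    rewrite !mxE/=; move: i; near: h; apply: filter_forall => /= i.
    exact: ((cvgrPdist_le _ _).1 (H i.1 i.2).1).
  have c2 : (fun h => (g h).2) @ 0^' --> l.2.
    apply/cvgrPdist_le => e e0; near=> h.
    rewrite /Num.Def.normr/= mx_normrE (bigmax_le _ (ltW e0))//= => i _.
    rewrite !mxE/=; move: i; near: h; apply: filter_forall => /= i.
    exact: ((cvgrPdist_le _ _).1 (H i.1 i.2).2).
  have -> : g = (fun h => ((g h).1, (g h).2)) by apply/funext => h; case: (g h).
  exact: (cvg_pair c1 c2).
split=> [[dfx <-] i j|H].
  have [E1 E2] := (cvgE _ _).1 dfx i j; split; apply: cvg_is_derive => /=.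
    by move: E1; under eq_fun do rewrite /= !mxE.
  by move: E2; under eq_fun do rewrite /= !mxE.
apply: cvg_is_derive; apply/cvgE => i j; have [[d1 <-] [d2 <-]] := H i j.
by split; under eq_fun do rewrite /= !mxE.
Unshelve. all: by end_near. Qed.

Lemma is_mderive_to_cplx m n (f : R -> reals R m n) s df :
  is_derive s (1 : R) f df <-> is_mderive (fun t => to_cplx (f t)) s (to_cplx df).
Proof.
rewrite is_derive_entries; split=> H i j; have [] := H i j.
  by split; rewrite ?to_cplx_re ?to_cplx_im; under eq_fun do rewrite ?to_cplx_re ?to_cplx_im.
by rewrite to_cplx_re to_cplx_im; under eq_fun do rewrite to_cplx_re;
  move=> ?; under eq_fun do rewrite to_cplx_im.
Qed.

End ComplexDerivative.

(** * Projectors and the complex-linear part *)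

(** Used with [w] the adjoint of [z]: it annihilates tangent vectors, so only the coefficient of [z]
    survives. *)
Lemma mulmx_comb_eq0 (K : comNzRingType) n (w : 'rV[K]_n) (z y x : 'cV[K]_n) (c i : K) :
  w *m y = 0 -> w *m x = 0 -> c *: z + (y - i *: x) = 0 -> c *: (w *m z) = 0.
Proof.
move=> wy wx /(congr1 (mulmx w)).
by rewrite mulmx0 mulmxDr mulmxBr -!scalemxAr wy wx scaler0 subr0 addr0.
Qed.

Section Adjoint.
Variable R : realType.
Local Notation C := (Cx R).
Local Notation I := (Complex 0 1 : C).

Lemma adjM m n p (A : 'M[C]_(m, n)) (B : 'M[C]_(n, p)) :
  (A *m B)^t* = B^t* *m A^t*.
Proof. by rewrite trmx_mul map_mxM. Qed.

Lemma adjE m n (A : 'M[C]_(m, n)) i j : A^t* i j = (A j i)^*.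
Proof. by rewrite !mxE. Qed.

Lemma adjZ m n (a : C) (A : 'M[C]_(m, n)) : (a *: A)^t* = a^* *: A^t*.
Proof. by rewrite linearZ map_mxZ. Qed.

Lemma mxtrace_adj n (A : 'M[C]_n) : \tr (A^t*) = (\tr A)^*.
Proof. by rewrite rmorph_sum; apply: eq_bigr => i _; rewrite adjE. Qed.

Lemma conjE (x : C) : x^* = Complex (complex.Re x) (- complex.Im x).
Proof. by case: x. Qed.

Lemma cReN (x : C) : complex.Re (- x) = - complex.Re x.
Proof. by case: x. Qed.
Lemma cImN (x : C) : complex.Im (- x) = - complex.Im x.
Proof. by case: x. Qed.

Lemma cIm_conj (x : C) : complex.Im x^* = - complex.Im x.
Proof. by rewrite conjE. Qed.

Lemma sqmxE n (z : 'cV[C]_n) : (z^t* *m z) 0 0 = \sum_k `|z k 0| ^+ 2.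
Proof. by rewrite mxE; apply: eq_bigr => k _; rewrite adjE normCKC. Qed.

Lemma sqmx_ge0 n (z : 'cV[C]_n) : 0 <= (z^t* *m z) 0 0.
Proof. by rewrite sqmxE sumr_ge0 // => k _; rewrite exprn_ge0. Qed.

Lemma sqmx_eq0 n (z : 'cV[C]_n) : ((z^t* *m z) 0 0 == 0) = (z == 0).
Proof.
apply/idP/eqP => [|->]; last by rewrite mulmx0 mxE.
rewrite sqmxE psumr_eq0 => [/allP H|k _]; last by rewrite exprn_ge0.
apply/matrixP => k j; rewrite ord1 mxE; apply/eqP.
by have := H k (mem_index_enum k); rewrite expf_eq0 normr_eq0.
Qed.

Lemma sqmx_conj n (z : 'cV[C]_n) : ((z^t* *m z) 0 0)^* = (z^t* *m z) 0 0.
Proof. by apply/CrealP; apply: ger0_real; exact: sqmx_ge0. Qed.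

(** The orthogonal projector onto the line of [z], and 0 when z = 0; [projector L] is [outer] of a
    vector picked in [L]. *)
Definition outer n (z : 'cV[C]_n) : 'M[C]_n := ((z^t* *m z) 0 0)^-1 *: (z *m z^t*).

Lemma outerZ n (a : C) (z : 'cV[C]_n) : a != 0 -> outer (a *: z) = outer z.
Proof.
move=> a0; rewrite /outer adjZ -!scalemxAl -!scalemxAr !mxE !scalerA.
have ac0 : a^* != 0 by rewrite conjC_eq0.
congr (_ *: _); move: (\sum_j _) => s.
have [->|s0] := eqVneq s 0; first by rewrite !mulr0 invr0 !mul0r.
by field; rewrite s0 a0 ac0.
Qed.

Lemma outer_adj n (z : 'cV[C]_n) : (outer z)^t* = outer z.
Proof. by rewrite /outer adjZ adjM trmxCK fmorphV /= sqmx_conj. Qed.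

Lemma outer_mul n (z : 'cV[C]_n) : z != 0 -> outer z *m z = z.
Proof.
move=> z0; rewrite /outer -scalemxAl -mulmxA [X in z *m X]mx11_scalar mul_mx_scalar.
by rewrite scalerA mulVf ?scale1r // sqmx_eq0.
Qed.

Lemma outer_mulr n (z y : 'cV[C]_n) :
  outer z *m y = (((z^t* *m z) 0 0)^-1 * (z^t* *m y) 0 0) *: z.
Proof.
by rewrite /outer -scalemxAl -mulmxA [X in z *m X]mx11_scalar mul_mx_scalar scalerA.
Qed.

Lemma outer_idem n (z : 'cV[C]_n) : outer z *m outer z = outer z.
Proof.
have [->|z0] := eqVneq z 0; first by rewrite /outer mul0mx scaler0 mulmx0.
by rewrite {2}/outer -scalemxAr mulmxA outer_mul.
Qed.

Lemma outer_unitary n (A : 'M[C]_n) (z : 'cV[C]_n) : A \is unitarymx ->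
  outer (A *m z) = A *m outer z *m A^t*.
Proof.
move=> /unitarymxP AA; have AA' := mulmx1C AA.
rewrite /outer adjM -scalemxAr -scalemxAl !mulmxA.
by rewrite -(mulmxA (z^t*)) AA' mulmx1.
Qed.

Lemma trace_outer n (z : 'cV[C]_n) (X Y : 'M[C]_n) :
  \tr (outer z *m X *m Y) = ((z^t* *m z) 0 0)^-1 * (z^t* *m (X *m (Y *m z))) 0 0.
Proof.
rewrite /outer -!scalemxAl mxtraceZ -!mulmxA mxtrace_mulC -!mulmxA.
by rewrite trace_mx11.
Qed.

Lemma vline_scale n (L : {vspace 'cV[C]_n}) z y :
  L = <[z]>%VS -> y \in L -> exists a, y = a *: z.
Proof. by move=> -> /vlineP. Qed.

Lemma projectorE n (L : proj_space 'cV[C]_n) z :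
  sval L = <[z]>%VS -> projector L = outer z.
Proof.
move=> Lz; rewrite -/(outer _).
have [a E] := vline_scale Lz (memv_pick (sval L)).
have p0 : vpick (sval L) != 0.
  by rewrite vpick0 -dimv_eq0 (eqP (svalP L)).
rewrite /projector -/(outer _) E outerZ //.
by apply: contraNneq p0 => a0; rewrite E a0 scale0r.
Qed.

(** The hypotheses on [X], [Y], [Z] are the linearization of [M *m M = M]. Moving the involution [S]
    around the trace past all three factors produces three signs, so the trace is its own
    opposite. *)
Lemma odd_trace n (M X Y Z : 'M[C]_n) : M *m M = M ->
  X *m M + M *m X = X -> Y *m M + M *m Y = Y -> Z *m M + M *m Z = Z ->
  \tr (X *m Y *m Z) = 0.
Proof.
move=> MM oX oY oZ; pose S : 'M[C]_n := 1%:M - M - M.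
have SS : S *m S = 1%:M.
  rewrite /S !mulmxBr !mulmxBl !mulmx1 !mul1mx MM; move: 1%:M => U.
  by apply/matrixP => i j; rewrite !mxE; ring.
have odd W : W *m M + M *m W = W -> S *m W = - (W *m S).
  rewrite /S !mulmxBr !mulmxBl mulmx1 mul1mx; move: (W *m M) (M *m W) => a b <-.
  by apply/matrixP => i j; rewrite !mxE; ring.
have : \tr (X *m Y *m Z) = - \tr (X *m Y *m Z).
  rewrite -[in LHS](mulmx1 (X *m Y *m Z)) -SS mulmxA mxtrace_mulC !mulmxA.
  rewrite (odd _ oX) !mulNmx -(mulmxA X S) (odd _ oY) !mulmxN !mulNmx -!mulmxA.
  by rewrite opprK (mulmxA S Z) (odd _ oZ) mulNmx -(mulmxA Z) SS mulmx1 !mulmxN linearN.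
by move/eqP; rewrite -subr_eq0 opprK -mulr2n mulrn_eq0 /= => /eqP.
Qed.

(** For Hermitian factors, taking adjoints reverses the product and conjugates the trace. *)
Lemma trace_swap_adj n (M X Y : 'M[C]_n) :
  M^t* = M -> X^t* = X -> Y^t* = Y ->
  complex.Im (\tr (M *m X *m Y)) = - complex.Im (\tr (M *m Y *m X)).
Proof.
move=> hM hX hY; rewrite -cIm_conj -mxtrace_adj !adjM hM hX hY.
by rewrite mulmxA [in RHS]mxtrace_mulC mulmxA.
Qed.

(** The real-linear map on C^n sending the k-th basis vector to [A k] and i times it to [B k]. *)
Definition real_comb n m (A B : 'I_n -> 'M[C]_m) (v : 'cV[C]_n) : 'M[C]_m :=
  \sum_k ((Complex (complex.Re (v k 0)) 0 : C) *: A k +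
          (Complex (complex.Im (v k 0)) 0 : C) *: B k).

(* With [A k], [B k] the derivatives along the k-th coordinate and along [i]
   times it, [A k - i B k] is twice the complex-linear part. *)
Definition frame_mx n (P : 'M[C]_n.+1) (A B : 'I_n.+1 -> 'M[C]_n.+1) (m : 'I_n.+1) :
  'M[C]_n.+1 := if m == ord0 then P else A m - I *: B m.

(** Although X is only real-linear, X v - i X (i v) is complex-linear in v, hence determined by its
    values on the basis. *)
Lemma real_comb_split n m (A B : 'I_n -> 'M[C]_m) (v : 'cV[C]_n) :
  real_comb A B v - I *: real_comb A B (I *: v) =
  \sum_k v k 0 *: (A k - I *: B k).
Proof.
rewrite /real_comb scaler_sumr -sumrB; apply: eq_bigr => k _.
have -> : (I *: v) k 0 = I * v k 0 by rewrite mxE.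
move: (v k 0) (A k) (B k) => x M N.
have e1 : x = (Complex (complex.Re x) 0 : C) - I * (Complex (complex.Re (I * x)) 0 : C).
  by case: (x) => a b; apply: cReIm_inj; rewrite /=; ring.
have e2 : - (x * I) = (Complex (complex.Im x) 0 : C) - I * (Complex (complex.Im (I * x)) 0 : C).
  by case: (x) => a b; apply: cReIm_inj; rewrite /=; ring.
have split2 (K : pzRingType) (V : lmodType K) (a b c d i : K) (u w : V) :
    a *: u + b *: w - i *: (c *: u + d *: w) = (a - i * c) *: u + (b - i * d) *: w.
  by rewrite scalerDr !scalerA opprD addrACA -!scalerBl.
by rewrite split2 -e1 -e2 scalerBr scalerA scaleNr.
Qed.

(* A real-linear symplectic map has an injective complex-linear part: if
   [X v = i X (i v)] then omega(X v, X (i v)) <= 0. *)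
Lemma frame_mx_free n (z : 'cV[C]_n.+1) (A B : 'I_n.+1 -> 'M[C]_n.+1)
    (X := real_comb A B) (c : 'I_n.+1 -> C) :
  z != 0 -> (forall v : 'cV[C]_n.+1, (X v)^t* = X v) ->
  (forall v : 'cV[C]_n.+1, X v *m outer z + outer z *m X v = X v) ->
  (forall v : 'cV[C]_n.+1, v 0 0 = 0 -> v != 0 ->
    0 < complex.Im (\tr (outer z *m X v *m X (I *: v)))) ->
  \sum_m c m *: (frame_mx (outer z) A B m *m z) = 0 -> forall m, c m = 0.
Proof.
move=> z0 hX oX pX Wc.
(* Index 0 is left out because [frame_mx] has the projector there: [c 0] is the coefficient of [z],
   and the other [c m] are those of a tangent vector. *)
pose v : 'cV[C]_n.+1 := \col_m (if m == 0 then 0 else c m : C).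
have vE m : v m 0 = if m == 0 then 0 else c m by rewrite mxE.
have XW : \sum_m c m *: (frame_mx (outer z) A B m *m z) =
    c 0 *: z + (X v - I *: X (I *: v)) *m z.
  rewrite real_comb_split big_ord_recl [in RHS]big_ord_recl vE eqxx scale0r add0r.
  rewrite {1}/frame_mx eqxx outer_mul // mulmx_suml; congr (_ + _).
  apply: eq_bigr => m _; rewrite vE /frame_mx !(eq_sym _ ord0) !(negPf (neq_lift _ _)).
  by rewrite scalemxAl.
have N0 : (z^t* *m z) 0 0 != 0 by rewrite sqmx_eq0.
(* Multiplying the oddness relation by the projector P gives P X P = 0, so X sends [z] into its
   orthogonal complement. *)
have zXz u : z^t* *m (X u *m z) = 0.
  have : outer z *m X u *m outer z = 0.
    have /(congr1 (fun Y => outer z *m Y)) := oX u.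
    rewrite mulmxDr !mulmxA outer_idem => /eqP; rewrite -subr_eq0 addrK.
    by move=> /eqP.
  move/(congr1 (fun Y => z^t* *m Y *m z)); rewrite mulmx0 mul0mx -!mulmxA outer_mul //.
  by rewrite mulmxA -[in X in X -> _](outer_adj z) -adjM outer_mul.
have v0 : c 0 = 0 /\ X v *m z = I *: (X (I *: v) *m z).
  have E : c 0 *: z + (X v *m z - I *: (X (I *: v) *m z)) = 0.
    by rewrite scalemxAl -mulmxBl -XW.
  have c0 : c 0 = 0.
    have /eqP := mulmx_comb_eq0 (zXz v) (zXz (I *: v)) E.
    rewrite scaler_eq0 => /orP[/eqP //|/eqP zz].
    by move: N0; rewrite zz mxE eqxx.
  by split=> //; apply/eqP; rewrite -subr_eq0 -[X in X == _]add0r -[X in X + _](scale0r z) -c0 E.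
have [c0 Xv] := v0.
have vz : v = 0.
  apply: contrapT => /eqP nv.
  have := pX v; rewrite vE eqxx => /(_ erefl nv).
  (* With y = X (i v) z and X v z = i y, the trace equals - i |y|^2 / |z|^2. Its imaginary part is
     not positive, against [pX]. *)
  have H : z^t* *m (X v *m (X (I *: v) *m z)) = (X v *m z)^t* *m (X (I *: v) *m z).
    by rewrite adjM hX -mulmxA.
  rewrite trace_outer H Xv.
  move: (X (I *: v) *m z) => y.
  rewrite adjZ -scalemxAl.
  have -> : (I^* *: (y^t* *m y)) 0 0 = I^* * (y^t* *m y) 0 0 by rewrite mxE.
  have := sqmx_ge0 y; have := sqmx_ge0 z; rewrite -invr_ge0.
  move: (_^-1) ((y^t* *m y) 0 0) => p q p0 q0; have := mulr_ge0 p0 q0.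
  rewrite mulrCA; move: (p * q) => {p0 q0} {}p; rewrite lecE => /andP[/eqP q0 q1].
  by rewrite cImM conjE /= mul0r add0r mulN1r oppr_gt0 ltNge q1.
move=> m; have [->//|m0] := eqVneq m 0.
by have := vE m; rewrite vz mxE (negPf m0).
Qed.

End Adjoint.

(** * Entrywise limits and homogeneous coordinates *)

Section EntrywiseLimits.
Variables (R : realType) (T : Type) (F : set_system T).
Context {FF : Filter F}.
Local Notation C := (Cx R).

Lemma cvg_real_complex (a : T -> R) (l : R) :
  a @ F --> l -> (fun t => Complex (a t) 0 : C) @ F --> (Complex l 0 : C).
Proof.
(* A positive element of [Cx R] has imaginary part 0, so its real part serves as a real epsilon. *)
move=> al; apply/cvgrPdist_lt => -[e e'] /=; rewrite ltcE /= => /andP[/eqP -> e0].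
have := al; move/cvgrPdist_lt => /(_ e e0); apply: filterS => t lt.
have -> : (Complex l 0 : C) - Complex (a t) 0 = Complex (l - a t) 0.
  by apply: cReIm_inj; rewrite !(cReD, cImD, cReN, cImN) /=; ring.
by rewrite normc_def /= expr0n addr0 sqrtr_sqr ltcE /= eqxx.
Qed.

Lemma cvg_Complex (a b : T -> R) (l m : R) :
  a @ F --> l -> b @ F --> m ->
  (fun t => Complex (a t) (b t) : C) @ F --> (Complex l m : C).
Proof.
move=> al bm.
have CE (x y : R) : (Complex x y : C) = (Complex x 0 : C) + (Complex 0 1 : C) * (Complex y 0 : C).
  by apply: cReIm_inj; rewrite !(cReM, cImM, cReD, cImD) /=; ring.
rewrite CE; under eq_fun do rewrite CE.
by apply: cvgD; [|apply: cvgM; first exact: cvg_cst]; exact: cvg_real_complex.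
Qed.

Lemma cvg_Im (z : T -> C) (l : C) :
  z @ F --> l -> (fun t => complex.Im (z t)) @ F --> complex.Im l.
Proof.
move=> zl; apply/cvgrPdist_lt => e e0.
have e0' : 0 < (Complex e 0 : C) by rewrite ltcE /= eqxx.
have := zl; move/cvgrPdist_lt => /(_ _ e0'); apply: filterS => t.
rewrite normc_def ltcE /= => /andP[_]; apply: le_lt_trans.
rewrite -cImN -cImD -sqrtr_sqr ler_sqrt ?addr_ge0 ?sqr_ge0 //.
by rewrite lerDr sqr_ge0.
Qed.

(** Entrywise, so that limits of products, traces, determinants and inverses reduce to finite sums
    and products in [Cx R]. *)
Definition mcvg m n (X : T -> 'M[C]_(m, n)) (L : 'M[C]_(m, n)) : Prop :=
  forall i j, (fun t => X t i j) @ F --> L i j.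

Lemma mcvgD m n (X Y : T -> 'M[C]_(m, n)) L K :
  mcvg X L -> mcvg Y K -> mcvg (fun t => X t + Y t) (L + K).
Proof.
by move=> XL YK i j; rewrite mxE; under eq_fun do rewrite mxE; exact: (cvgD (XL i j) (YK i j)).
Qed.

Lemma mcvgZ m n (a : C) (X : T -> 'M[C]_(m, n)) L :
  mcvg X L -> mcvg (fun t => a *: X t) (a *: L).
Proof.
move=> XL i j; rewrite mxE; under eq_fun do rewrite mxE.
by apply: cvgM; [exact: cvg_cst | exact: XL].
Qed.

Lemma cvg_bigsum (I : Type) (r : seq I) (P : pred I) (f : I -> T -> C) (l : I -> C) :
  (forall i, P i -> f i @ F --> l i) ->
  (fun t => \sum_(i <- r | P i) f i t) @ F --> \sum_(i <- r | P i) l i.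
Proof.
move=> fl; elim: r => [|i r IH].
  by rewrite big_nil; under eq_fun do rewrite big_nil; exact: cvg_cst.
rewrite big_cons; under eq_fun do rewrite big_cons.
by case: ifP => [/fl fi|_]; [exact: (cvgD fi IH) | exact: IH].
Qed.

Lemma mcvgM m n p (X : T -> 'M[C]_(m, n)) (Y : T -> 'M[C]_(n, p)) L K :
  mcvg X L -> mcvg Y K -> mcvg (fun t => X t *m Y t) (L *m K).
Proof.
move=> XL YK i j; rewrite mxE; under eq_fun do rewrite mxE.
by apply: cvg_bigsum => k _; exact: (cvgM (XL i k) (YK k j)).
Qed.

Lemma mcvg_trace n (X : T -> 'M[C]_n) L :
  mcvg X L -> (fun t => \tr (X t)) @ F --> \tr L.
Proof. by move=> XL; apply: cvg_bigsum => k _. Qed.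

Lemma mcvg_to_cplx m n (f : T -> reals R m n) (l : reals R m n) :
  f @ F --> l -> mcvg (fun t => to_cplx (f t)) (to_cplx l).
Proof.
move=> fl i j; rewrite mxE; under eq_fun do rewrite mxE.
have cij := @coord_continuous R m n i j.
have a : (fun h => (f h).1) @ F --> l.1 by exact: (cvg_comp _ _ fl cvg_fst).
have b : (fun h => (f h).2) @ F --> l.2 by exact: (cvg_comp _ _ fl cvg_snd).
by apply: cvg_Complex; [exact: (cvg_comp _ _ a (cij _)) | exact: (cvg_comp _ _ b (cij _))].
Qed.

End EntrywiseLimits.
Arguments mcvg {R T} F {m n}.

Section Homogeneous.
Variables (R : realType) (r : nat).
Local Notation C := (Cx R).
Local Notation CP := (proj_space 'cV[C]_r).
Local Notation embed := (@embed R r).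

Lemma of_cplxK m n : cancel (@of_cplx R m n) (@to_cplx R m n).
Proof.
by move=> A; apply/matrixP => i j; rewrite mxE !mxE; case: (A i j).
Qed.

Lemma to_cplxK m n : cancel (@to_cplx R m n) (@of_cplx R m n).
Proof.
by case=> a b; rewrite /of_cplx; congr pair; apply/matrixP => i j; rewrite !mxE.
Qed.

Lemma to_cplx0 m n : to_cplx (0 : reals R m n) = 0.
Proof. by apply/matrixP => i j; apply: cReIm_inj; rewrite !mxE. Qed.

Lemma exists_line (z : 'cV[C]_r) : z != 0 -> exists L : CP, sval L = <[z]>%VS.
Proof.
move=> z0; have d : \dim <[z]>%VS == 1%N by rewrite dim_vline z0.
by exists (exist _ <[z]>%VS d).
Qed.

Lemma homogE (W : zmodType) (f : CP -> W) (p : reals R r 1) (L : CP) :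
  sval L = <[to_cplx p]>%VS -> homog f p = f L.
Proof.
move=> Lp; rewrite /homog -Lp.
by rewrite (valK L).
Qed.

Lemma nonzero_line (L : CP) (z : 'cV[C]_r) : sval L = <[z]>%VS -> z != 0.
Proof.
move=> Lz; apply/eqP => z0; have /eqP := svalP L; rewrite Lz z0.
by rewrite dim_vline eqxx.
Qed.

Lemma nonzeroP (p : reals R r 1) : nonzero p -> exists L : CP, sval L = <[to_cplx p]>%VS.
Proof. exact: exists_line. Qed.

(** The span of the zero vector is not a line, so [insub] fails and the default 0 appears. As 0 is
    Hermitian and idempotent, the two matrix identities below hold at every [p]. *)
Lemma homog0 (W : zmodType) (f : CP -> W) (p : reals R r 1) :
  ~ nonzero p -> homog f p = 0.
Proof.
move=> /negP; rewrite negbK => /eqP p0; rewrite /homog p0 insubN //.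
by rewrite dim_vline eqxx.
Qed.

Lemma open_nonzero : open (@nonzero R r).
Proof.
have -> : @nonzero R r = ~` [set 0].
  apply/seteqP; split => p /=.
    by move=> pn p0; move: pn; rewrite /nonzero /= p0 to_cplx0 eqxx.
  move=> pn; apply/eqP => pE; apply: pn.
  rewrite -[p]to_cplxK pE -[LHS]to_cplxK of_cplxK.
  by rewrite -[RHS]to_cplxK to_cplx0.
by apply/closed_openC/accessible_closed_set1/hausdorff_accessible/norm_hausdorff.
Qed.

Lemma projector_adj (L : CP) : (projector L)^t* = projector L.
Proof. exact: outer_adj. Qed.

Lemma projector_idem (L : CP) : projector L *m projector L = projector L.
Proof. exact: outer_idem. Qed.

Lemma homog_embed_adj (psi : CP -> CP) p :
  (to_cplx (homog (embed \o psi) p))^t* = to_cplx (homog (embed \o psi) p).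
Proof.
have [/nonzeroP[L Lp]|n0] := pselect (nonzero p).
  by rewrite (homogE _ Lp) /= of_cplxK projector_adj.
by rewrite homog0 // to_cplx0; apply/matrixP => i j; rewrite adjE !mxE rmorph0.
Qed.

Lemma homog_embed_idem (psi : CP -> CP) p (M := to_cplx (homog (embed \o psi) p)) :
  M *m M = M.
Proof.
rewrite /M; have [/nonzeroP[L Lp]|n0] := pselect (nonzero p).
  by rewrite (homogE _ Lp) /= of_cplxK projector_idem.
by rewrite homog0 // to_cplx0 mulmx0.
Qed.

End Homogeneous.

Section MoreDerivatives.
Variable R : realType.

Lemma is_mderive_adj m n (X : R -> 'M[Cx R]_(m, n)) s dX :
  is_mderive X s dX -> is_mderive (fun t => (X t)^t*) s (dX^t*).
Proof.
move=> dx i j; rewrite adjE; under eq_fun do rewrite adjE.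
have [a b] := dx j i; split.
  by rewrite conjE; under eq_fun do rewrite conjE.
by rewrite cIm_conj; under eq_fun do rewrite cIm_conj; exact: is_deriveN.
Qed.

Lemma is_derive_snd (U V W : normedModType R) (F : U * V -> W) t x v dF :
  is_derive ((t, x) : U * V) ((0, v) : U * V) F dF <->
  is_derive x v (fun y => F (t, y)) dF.
Proof.
have E : (fun h : R => h^-1 *: ((F \o shift ((t, x) : U * V)) (h *: ((0, v) : U * V)) - F (t, x))) =
   (fun h : R => h^-1 *: (((fun y => F (t, y)) \o shift x) (h *: v) - F (t, x))).
  apply/funext => h /=; congr (_ *: (F _ - _)).
  by rewrite -[LHS]/(h *: 0 + t, h *: v + x) scaler0 add0r.
by split=> -[d1 d2]; apply: DeriveDef; move: d1 d2; rewrite /derivable /derive E.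
Qed.

Lemma is_derive_fst (V W : normedModType R) (F : R^o * V -> W) (t : R) x dF :
  is_derive ((t, x) : R^o * V) ((1, 0) : R^o * V) F dF <->
  is_derive t (1 : R) (fun s : R => F (s, x)) dF.
Proof.
have E : (fun h : R => h^-1 *: ((F \o shift ((t, x) : R^o * V)) (h *: ((1, 0) : R^o * V)) - F (t, x))) =
   (fun h : R => h^-1 *: (((fun s : R => F (s, x)) \o shift t) (h *: 1) - F (t, x))).
  apply/funext => h /=; congr (_ *: (F _ - _)).
  by rewrite -[LHS]/(h *: 1 + t, h *: 0 + x) scaler0 add0r.
by split=> -[d1 d2]; apply: DeriveDef; move: d1 d2; rewrite /derivable /derive E.
Qed.

End MoreDerivatives.

Lemma line_of_projection (R : realType) r (L : proj_space 'cV[Cx R]_r) (y : 'cV[Cx R]_r) :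
  projector L *m y != 0 -> sval L = <[projector L *m y]>%VS.
Proof.
set z := vpick (sval L) => n0; apply/esym/eqP.
rewrite eqEdim (eqP (svalP L)) dim_vline n0 leqnn andbT.
rewrite -memvE /projector -/(outer _) outer_mulr.
by apply: memvZ; exact: memv_pick.
Qed.

Lemma projector_mul (R : realType) r (L : proj_space 'cV[Cx R]_r) (y : 'cV[Cx R]_r) :
  y \in sval L -> projector L *m y = y.
Proof.
have [->|y0] := eqVneq y 0; first by rewrite mulmx0.
move=> yL; rewrite (@projectorE _ _ _ y) ?outer_mul //; apply/esym/eqP.
by rewrite eqEdim (eqP (svalP L)) dim_vline y0 leqnn andbT -memvE.
Qed.

Section Entries.
Variables (R : realType) (T : topologicalType) (m n : nat).

Lemma continuous_entry1 (f : T -> reals R m n) x i j :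
  {for x, continuous f} -> {for x, continuous (fun y => (f y).1 i j)}.
Proof.
move=> cf; have a : (fun y => (f y).1) @ x --> (f x).1 by exact: (cvg_comp _ _ cf cvg_fst).
exact: (cvg_comp _ _ a (@coord_continuous R m n i j _)).
Qed.

Lemma continuous_entry2 (f : T -> reals R m n) x i j :
  {for x, continuous f} -> {for x, continuous (fun y => (f y).2 i j)}.
Proof.
move=> cf; have a : (fun y => (f y).2) @ x --> (f x).2 by exact: (cvg_comp _ _ cf cvg_snd).
exact: (cvg_comp _ _ a (@coord_continuous R m n i j _)).
Qed.

Lemma to_cplx_entry (p q : reals R m n) i j :
  p.1 i j = q.1 i j -> p.2 i j = q.2 i j -> to_cplx p i j = to_cplx q i j.
Proof. by rewrite !mxE => -> ->. Qed.

End Entries.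

(** * Real coordinate directions and the chain rule at a fixed time *)

Section TimeDirections.
Variables (R : realType) (r : nat).
Definition time_space : normedModType R := (R^o * reals R r 1)%type.
Local Notation V := time_space.

Definition coord_dir (i : 'I_r + 'I_r) : reals R r 1 :=
  match i with inl k => (delta_mx k 0, 0) | inr k => (0, delta_mx k 0) end.
Definition coord_val (i : 'I_r + 'I_r) (p : reals R r 1) : R :=
  match i with inl k => p.1 k 0 | inr k => p.2 k 0 end.

Lemma coord_dir_sum (p : reals R r 1) :
  p = \sum_i coord_val i p *: coord_dir i.
Proof.
have E (a : 'cV[R]_r) : a = \sum_k a k 0 *: delta_mx k 0.
  rewrite [LHS]matrix_sum_delta; apply: eq_bigr => k _.
  by rewrite big_ord_recl big_ord0 addr0.
rewrite big_sumType /=; case: p => a b /=; apply/eqP; rewrite -[_ == _]/(_ && _).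
rewrite !raddfD !raddf_sum /=.
have Z (c : 'cV[R]_r) : \sum_i c i 0 *: (0 : 'cV[R]_r) = 0.
  by rewrite big1 // => i _; rewrite scaler0.
by rewrite !Z addr0 add0r -!E !eqxx.
Qed.

Lemma coord_dir_time (p : reals R r 1) :
  ((0, p) : V) = \sum_i coord_val i p *: ((0, coord_dir i) : V).
Proof.
apply/eqP; rewrite -[_ == _]/(_ && _) !raddf_sum /= -coord_dir_sum eqxx andbT.
by rewrite big1 // => i _; rewrite scaler0.
Qed.

(* The chain rule along a curve, for functions that only have continuous
   directional derivatives. *)
Lemma is_derive_time_curve (f : V -> R) (df : V -> V -> R) (A : set V) (t : R)
    (q : R -> reals R r 1) (dq : reals R r 1) :
  open A -> A (t, q 0) -> (forall y v, A y -> is_derive y v f (df v y)) ->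
  (forall y v, A y -> {for y, continuous (df v)}) ->
  is_derive (0 : R) (1 : R) q dq ->
  is_derive (0 : R) (1 : R) (fun s => f (t, q s)) (df (0, dq) (t, q 0)).
Proof.
move=> oA Aq dfA cf dq0.
have nA : nbhs ((t, q 0) : V) A by apply: open_nbhs_nbhs.
have dk i : is_derive (0 : R) (1 : R) (fun s => coord_val i (q s)) (coord_val i dq).
  by have /is_derive_entries H := dq0; case: i => k; have [] := H k 0.
have := is_derive_curve (index_enum _) (fun i => ((0, coord_dir i) : V)) nA dfA
  (fun v => cf _ v Aq) dk.
rewrite -coord_dir_time; apply: near_eq_is_derive; near=> s.
congr f; rewrite -[q s in RHS](subrKC (q 0)).
have -> : (t, q 0 + (q s - q 0)) = ((t, q 0) : V) + ((0, q s - q 0) : V).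
  by rewrite -[RHS]/(t + 0, _) addr0.
congr (_ + _); rewrite [in RHS]coord_dir_time; apply: eq_bigr => i _.
by congr (_ *: _); case: i => k /=; rewrite !mxE.
Unshelve. all: by end_near. Qed.

End TimeDirections.

(** * Hamiltonian flows are symplectic *)

Section Flow.
Variables (R : realType) (r : nat).
Local Notation C := (Cx R).
Local Notation CP := (proj_space 'cV[C]_r).
Local Notation V := (time_space R r).
Local Notation embed := (@embed R r).
Variables (h : R -> CP -> R) (phi : R -> CP -> CP).
Hypothesis flow : hamiltonian_flow h phi.

Definition flow_dom : set V := [set q | nonzero q.2].
Definition flow_map (q : V) : reals R r r := homog (embed \o phi q.1) q.2.
(** The head of [us] is the direction of the last differentiation. *)
Definition flow_mx (us : seq V) (q : V) : 'M[C]_r :=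
  to_cplx (iter_derive us flow_map q).
Local Notation A := flow_dom.
Local Notation F := flow_map.
Local Notation M := flow_mx.

Lemma open_flow_dom : open A.
Proof.
have -> : A = (fun q : V => q.2) @^-1` (@nonzero R r) by [].
by apply: open_comp; [move=> q _; exact: cvg_snd | exact: open_nonzero].
Qed.

Lemma flow_smooth : smooth_on A F.
Proof. by case: flow. Qed.

Lemma iter_derive_flow us q u : A q ->
  is_derive q u (iter_derive us F) (iter_derive (u :: us) F q).
Proof. by move=> Aq; apply: derivableP; have [_] := flow_smooth us Aq; apply. Qed.

Lemma iter_derive_flow_continuous us q : A q -> {for q, continuous (iter_derive us F)}.
Proof. by move=> Aq; have [] := flow_smooth us Aq. Qed.

Lemma near_line (W : normedModType R) (B : set W) (q u : W) : open B -> B q ->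
  \forall s \near (0 : R), B (q + s *: u).
Proof.
move=> oB Bq.
have c : (fun s : R => q + s *: u) @ (0 : R) --> q + (0 : R) *: u.
  by apply: cvgD; [exact: cvg_cst | apply: cvgZr_tmp; exact: cvg_id].
by rewrite scale0r addr0 in c; apply: c; apply: open_nbhs_nbhs.
Qed.

Lemma flow_mx_derive us q u : A q ->
  is_mderive (fun s : R => M us (q + s *: u)) 0 (M (u :: us) q).
Proof.
move=> Aq; apply/is_mderive_to_cplx.
have := iter_derive_flow us u Aq; rewrite -{1}[q]addr0 -(scale0r u).
by move/is_derive_line.
Qed.

Lemma flow_mx_adj us q : A q -> (M us q)^t* = M us q.
Proof.
elim: us q => [|u us IH] q Aq; first exact: homog_embed_adj.
have H := flow_mx_derive us u Aq.
apply: is_mderive_unique (is_mderive_adj H) _.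
apply: near_is_mderive H; have := near_line u open_flow_dom Aq.
by apply: filterS => s As; rewrite IH.
Qed.

(** Obtained by differentiating [M *m M = M]; equivalently, the derivative anticommutes with the
    reflection 1 - 2 M. *)
Lemma flow_mx_odd q u : A q ->
  M [:: u] q *m M [::] q + M [::] q *m M [:: u] q = M [:: u] q.
Proof.
move=> Aq; have H := flow_mx_derive [::] u Aq.
have := is_mderiveM H H; rewrite scale0r addr0 => HM.
apply: is_mderive_unique HM _.
under eq_fun do rewrite /flow_mx /= /flow_map homog_embed_idem.
exact: H.
Qed.

Lemma flow_mx_swap q u v : A q -> M [:: u; v] q = M [:: v; u] q.
Proof.
move=> Aq; apply/matrixP => i j.
have nA : nbhs q A by apply: open_nbhs_nbhs; split => //; exact: open_flow_dom.
have re us y w : A y -> is_derive y w (fun y => (iter_derive us F y).1 i j)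
    ((iter_derive (w :: us) F y).1 i j).
  by move=> Ay; have /is_derive_entries/(_ i j)[] := iter_derive_flow us w Ay.
have im us y w : A y -> is_derive y w (fun y => (iter_derive us F y).2 i j)
    ((iter_derive (w :: us) F y).2 i j).
  by move=> Ay; have /is_derive_entries/(_ i j)[] := iter_derive_flow us w Ay.
have rec us : {for q, continuous (fun y => (iter_derive us F y).1 i j)}.
  exact: continuous_entry1 (iter_derive_flow_continuous Aq).
have imc us : {for q, continuous (fun y => (iter_derive us F y).2 i j)}.
  exact: continuous_entry2 (iter_derive_flow_continuous Aq).
apply: to_cplx_entry.
  exact: (derive_swap nA (fun y Ay => re [::] y v Ay) (fun y Ay => re [::] y u Ay)
    (fun y Ay => re [:: v] y u Ay) (fun y Ay => re [:: u] y v Ay)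
    (rec [:: u; v]) (rec [:: v; u])).
exact: (derive_swap nA (fun y Ay => im [::] y v Ay) (fun y Ay => im [::] y u Ay)
    (fun y Ay => im [:: v] y u Ay) (fun y Ay => im [:: u] y v Ay)
    (imc [:: u; v]) (imc [:: v; u])).
Qed.

Local Notation T := ((1, 0) : V).
Local Notation X v := ((0, v) : V).

Lemma flow_mx_derive_time us (t : R) p : nonzero p ->
  is_mderive (fun s : R => M us (s, p)) t (M (T :: us) (t, p)).
Proof.
move=> np; apply/is_mderive_to_cplx; apply/is_derive_fst.
exact: (@iter_derive_flow us (t, p) T np).
Qed.

Lemma flow_mx_derive_space us (t : R) p v : nonzero p ->
  is_mderive (fun s : R => M us (t, p + s *: v)) 0 (M (X v :: us) (t, p)).
Proof.
move=> np; have := @flow_mx_derive us (t, p) (X v) np.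
have -> // : (fun s : R => M us ((t, p) + s *: X v)) = (fun s : R => M us (t, p + s *: v)).
apply/funext => s; congr (M us _).
by rewrite -[LHS]/(t + s *: 0, p + s *: v) scaler0 addr0.
Qed.

Lemma flow_mxE (t : R) p (L : CP) : sval L = <[to_cplx p]>%VS ->
  M [::] (t, p) = projector (phi t L).
Proof. by move=> Lp; rewrite /flow_mx /= /flow_map (homogE _ Lp) /= of_cplxK. Qed.

Lemma nonzero_of_cplx (z : 'cV[C]_r) : z != 0 -> nonzero (of_cplx z).
Proof. by rewrite /nonzero /= of_cplxK. Qed.

Lemma flow0 (p : reals R r 1) : F (0, p) = homog embed p.
Proof.
have E : embed \o phi 0 = embed by apply/funext => L /=; case: flow => _ _ -> _.
by rewrite /flow_map E.
Qed.

Lemma hamiltonian_smooth : smooth_on A (fun q : V => homog (h q.1) q.2 : R^o).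
Proof. by case: flow. Qed.

(* The one-form [omega (dphi/dt, -)] pulled back by [phi t] is the differential
   of [h t \o phi t]. *)
Lemma pullback_hamiltonian (t : R) p w : 0 <= t <= 1 -> nonzero p ->
  is_derive p w (homog (h t \o phi t) : reals R r 1 -> R^o)
    (fubini_study (M [::] (t, p)) (M [:: T] (t, p)) (M [:: X w] (t, p))).
Proof.
move=> t01 np; have [L Lp] := nonzeroP np.
pose z0 := vpick (sval (phi t L)).
have z0L : z0 \in sval (phi t L) by exact: memv_pick.
have z0n : z0 != 0 by rewrite vpick0 -dimv_eq0 (eqP (svalP (phi t L))).
have Lz0 : sval (phi t L) = <[z0]>%VS.
  by apply/esym/eqP; rewrite eqEdim (eqP (svalP (phi t L))) dim_vline z0n leqnn andbT -memvE.
(* A lift to homogeneous coordinates of the curve s -> phi_t [p + s w]: the fixed vector [z0] is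
   projected onto the moving line. It starts at [z0], and its velocity is the derivative of the
   projector applied to [z0]. *)
pose zc (s : R) := M [::] (t, p + s *: w) *m z0.
pose qc (s : R) : reals R r 1 := of_cplx (zc s).
have qc0 : qc 0 = of_cplx z0.
  by rewrite /qc /zc scale0r addr0 (flow_mxE _ Lp) projector_mul.
pose dq : reals R r 1 := of_cplx (M [:: X w] (t, p) *m z0).
have dqc : is_derive (0 : R) (1 : R) qc dq.
  apply/is_mderive_to_cplx; rewrite /qc /dq of_cplxK.
  under eq_fun do rewrite of_cplxK.
  have := is_mderiveM (flow_mx_derive_space [::] t w np) (is_mderive_cst z0 0).
  by rewrite mulmx0 addr0.
have nq0 : nonzero (qc 0) by rewrite qc0; exact: nonzero_of_cplx.
have near1 : \forall s \near (0 : R), nonzero (qc s).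
  have cq : {for (0 : R), continuous qc}.
    by apply/differentiable_continuous/derivable1_diffP; case: dqc.
  by apply: cq; apply: open_nbhs_nbhs; split => //; exact: open_nonzero.
have near2 : \forall s \near (0 : R), nonzero (p + s *: w).
  exact: near_line (@open_nonzero R r) np.
have nearE : \forall s \near (0 : R), homog (h t) (qc s) = homog (h t \o phi t) (p + s *: w)
    /\ homog embed (qc s) = F (t, p + s *: w).
  near=> s.
  have /nonzeroP[Ls Lsp] : nonzero (p + s *: w) by near: s; exact: near2.
  have nqs : nonzero (qc s) by near: s; exact: near1.
  have Lq : sval (phi t Ls) = <[to_cplx (qc s)]>%VS.
    move: nqs; rewrite /nonzero /= /qc of_cplxK /zc (flow_mxE _ Lsp).
    exact: line_of_projection.
  by rewrite !(homogE _ Lq) /flow_map !(homogE _ Lsp).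
have dh : is_derive (0 : R) (1 : R) (fun s => homog (h t) (qc s))
    ('D_dq (homog (h t) : reals R r 1 -> R^o) (qc 0)).
  have H := @is_derive_time_curve R r (fun q : V => homog (h q.1) q.2)
    (fun v => 'D_v (fun q : V => homog (h q.1) q.2 : R^o)) A t qc dq open_flow_dom nq0
    (fun y v Ay => derivableP ((hamiltonian_smooth [::] Ay).2 v))
    (fun y v Ay => (hamiltonian_smooth [:: v] Ay).1) dqc.
  have [_ E] : is_derive (qc 0) dq (homog (h t) : reals R r 1 -> R^o)
      ('D_(X dq) (fun q : V => homog (h q.1) q.2 : R^o) (t, qc 0)).
    have [H' _] := is_derive_snd (fun q : V => homog (h q.1) q.2 : R^o) t (qc 0) dq
      ('D_(X dq) (fun q : V => homog (h q.1) q.2 : R^o) (t, qc 0)).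
    apply: H'; apply: derivableP.
    exact: ((hamiltonian_smooth [::] (nq0 : A (t, qc 0))).2 (X dq)).
  by rewrite E.
(* Since [phi 0] is the identity, [homog embed] is [F] at time 0 and inherits the chain rule. Along
   the lift it agrees with [F] at time [t] along p + s w. *)
have de : 'D_dq (homog embed) (qc 0) = iter_derive [:: X w] F (t, p).
  have E1 : is_derive (0 : R) (1 : R) (fun s => F (0, qc s)) (iter_derive [:: X dq] F (0, qc 0)).
    apply/is_derive_entries => i j; split.
      apply: (@is_derive_time_curve R r (fun y => (F y).1 i j)
        (fun u y => (iter_derive [:: u] F y).1 i j) A 0 qc dq open_flow_dom) => //.
        by move=> y u Ay; have /is_derive_entries/(_ i j)[] := iter_derive_flow [::] u Ay.
      by move=> y u Ay; exact: continuous_entry1 (iter_derive_flow_continuous Ay).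
    apply: (@is_derive_time_curve R r (fun y => (F y).2 i j)
      (fun u y => (iter_derive [:: u] F y).2 i j) A 0 qc dq open_flow_dom) => //.
      by move=> y u Ay; have /is_derive_entries/(_ i j)[] := iter_derive_flow [::] u Ay.
    by move=> y u Ay; exact: continuous_entry2 (iter_derive_flow_continuous Ay).
  have E2 : is_derive (0 : R) (1 : R) (fun s => F (0, qc s)) (iter_derive [:: X w] F (t, p)).
    have := (is_mderive_to_cplx _ _ _).2 (flow_mx_derive_space [::] t w np).
    apply: near_eq_is_derive; apply: filterS nearE => s [_ E].
    exact: (etrans (esym E) (esym (flow0 (qc s)))).
  have [_ E3] : is_derive (qc 0) dq (homog embed) (iter_derive [:: X dq] F (0, qc 0)).
    have [H' _] := is_derive_snd F 0 (qc 0) dq (iter_derive [:: X dq] F (0, qc 0)).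
    have H'' := H' (@iter_derive_flow [::] (0, qc 0) (X dq) nq0).
    have FE : (fun y => F (0, y)) = homog embed by apply/funext => y; exact: flow0.
    by rewrite FE in H''.
  have [_ D1] := E1; have [_ D2] := E2.
  exact: (etrans E3 (etrans (esym D1) D2)).
have dt : derive1 (fun s : R => embed (phi s L)) t = iter_derive [:: T] F (t, p).
  have FE : (fun s : R => embed (phi s L)) = (fun s : R => F (s, p)).
    by apply/funext => s; rewrite /flow_map (homogE _ Lp).
  have [H' _] := @is_derive_fst R _ _ F t p (iter_derive [:: T] F (t, p)).
  have [_ E] := H' (@iter_derive_flow [::] (t, p) T np).
  by rewrite FE derive1E; exact: E.
have Lq0 : sval (phi t L) = <[to_cplx (qc 0%R)]>%VS by rewrite qc0 of_cplxK.
(* The Hamilton equation is read at the representative [z0] of the image line, in the direction of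
   the lift's velocity. *)
have [_ _ _ Hflow] := flow.
have E := Hflow t L _ dq t01 nq0 Lq0.
rewrite dt de -(flow_mxE t Lp) in E.
have {}E : fubini_study (M [::] (t, p)) (M [:: T] (t, p)) (M [:: X w] (t, p)) =
    'D_dq (homog (h t) : reals R r 1 -> R^o) (qc 0) := E.
rewrite E.
rewrite -[p in is_derive p]addr0 -(scale0r w); apply/is_derive_line.
by apply: near_eq_is_derive dh; apply: filterS nearE => s [].
Unshelve. all: by end_near. Qed.

End Flow.

Lemma derive0_constant (R : realType) (f : R -> R) :
  (forall s : R, 0 <= s <= 1 -> is_derive s (1 : R) f 0) -> f 1 = f 0.
Proof.
move=> df; have {}df (s : R) : s \in `[0, 1]%R -> is_derive s (1 : R) f 0.
  by rewrite in_itv /= => /df.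
have fc : {within `[(0 : R), 1], continuous f}.
  by apply: derivable_within_continuous => s /df[].
have d0 (s : R) : s \in `](0 : R), 1[%R -> is_derive s (1 : R) f 0.
  by move=> s01; apply: df; apply: subset_itv_oo_cc.
have [c _ E] := MVT_segment ler01 d0 fc.
by move: E; rewrite mul0r => /subr0_eq.
Qed.

(** * Algebra of the Fubini-Study form on projectors *)

Section FubiniStudy.
Variables (R : realType) (r : nat).
Local Notation C := (Cx R).

Lemma fubini_study_derive (P X Y : R -> 'M[C]_r) s dP dX dY :
  is_mderive P s dP -> is_mderive X s dX -> is_mderive Y s dY ->
  is_derive s (1 : R) (fun t => fubini_study (P t) (X t) (Y t))
    (fubini_study dP (X s) (Y s) + fubini_study (P s) dX (Y s)
     + fubini_study (P s) (X s) dY).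
Proof.
move=> hP hX hY.
have [_ H] := is_mderive_trace (is_mderiveM (is_mderiveM hP hX) hY).
by apply: is_derive_eq H _; rewrite /fubini_study mulmxDl !mxtraceD !cImD.
Qed.

Lemma fubini_study_cvg (T : Type) (F : set_system T) {FF : Filter F}
    (P X Y : T -> 'M[C]_r) LP LX LY :
  mcvg F P LP -> mcvg F X LX -> mcvg F Y LY ->
  (fun t => fubini_study (P t) (X t) (Y t)) @ F --> fubini_study LP LX LY.
Proof.
by move=> hP hX hY; exact: (cvg_Im (mcvg_trace (mcvgM (mcvgM hP hX) hY))).
Qed.

Lemma fubini_study_swap (P X Y : 'M[C]_r) : P^t* = P -> X^t* = X -> Y^t* = Y ->
  fubini_study P X Y = - fubini_study P Y X.
Proof. exact: trace_swap_adj. Qed.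

Lemma fubini_study_odd (M P X Y : 'M[C]_r) : M *m M = M ->
  P *m M + M *m P = P -> X *m M + M *m X = X -> Y *m M + M *m Y = Y ->
  fubini_study P X Y = 0.
Proof. by move=> MM oP oX oY; rewrite /fubini_study (odd_trace MM oP oX oY). Qed.

(** The last hypothesis says that the pulled-back one-form is closed. On both sides the terms with
    three tangent factors vanish by [odd_trace], and skew-symmetry turns what remains of the
    conclusion into that hypothesis. *)
Lemma closed_form_derivative (M Mt Mv Mw Mvt Mwt Mvw Mwv : 'M[C]_r) :
  M *m M = M -> Mt *m M + M *m Mt = Mt ->
  Mv *m M + M *m Mv = Mv -> Mw *m M + M *m Mw = Mw ->
  M^t* = M -> Mv^t* = Mv -> Mwt^t* = Mwt -> Mvw = Mwv ->
  fubini_study Mv Mt Mw + fubini_study M Mvt Mw + fubini_study M Mt Mvw =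
    fubini_study Mw Mt Mv + fubini_study M Mwt Mv + fubini_study M Mt Mwv ->
  fubini_study Mt Mv Mw + fubini_study M Mvt Mw + fubini_study M Mv Mwt = 0.
Proof.
move=> MM ot ov ow aM av awt -> E.
rewrite (fubini_study_odd MM ot ov ow) add0r (fubini_study_swap aM av awt).
move: E; rewrite (fubini_study_odd MM ov ot ow) (fubini_study_odd MM ow ot ov) !add0r.
by move/addIr ->; rewrite subrr.
Qed.

Lemma fubini_study_outer (P X Y : 'M[C]_r) (z x y : 'cV[C]_r) :
  P = outer z -> X^t* = X -> X *m z = x -> Y *m z = y ->
  fubini_study P X Y = complex.Im (((z^t* *m z) 0 0)^-1 * (x^t* *m y) 0 0).
Proof.
move=> -> aX Xz Yz; rewrite /fubini_study trace_outer Yz.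
have E : z^t* *m X = x^t* by rewrite -{1}aX -adjM Xz.
by rewrite mulmxA E.
Qed.

End FubiniStudy.

Section Symplectic.
Variables (R : realType) (r : nat).
Local Notation C := (Cx R).
Local Notation CP := (proj_space 'cV[C]_r).
Local Notation V := (time_space R r).
Variables (h : R -> CP -> R) (phi : R -> CP -> CP).
Hypothesis flow : hamiltonian_flow h phi.
Local Notation A := (@flow_dom R r).
Local Notation M := (flow_mx phi).
Local Notation T := ((1, 0) : V).
Local Notation X v := ((0, v) : V).

(** The product rule for the derivative along [v] of the pulled-back one-form evaluated on [w]. *)
Let form_derivative (v w : reals R r 1) (q : V) : R :=
  fubini_study (M [:: X v] q) (M [:: T] q) (M [:: X w] q)
  + fubini_study (M [::] q) (M [:: X v; T] q) (M [:: X w] q)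
  + fubini_study (M [::] q) (M [:: T] q) (M [:: X v; X w] q).

Lemma pullback_form_derive (t : R) p v w : nonzero p ->
  is_derive p v
    (fun p => fubini_study (M [::] (t, p)) (M [:: T] (t, p)) (M [:: X w] (t, p)))
    (form_derivative v w (t, p)).
Proof.
move=> np; rewrite -[p in is_derive p]addr0 -(scale0r v); apply/is_derive_line.
have D us := flow_mx_derive_space flow us t v np.
have := fubini_study_derive (D [::]) (D [:: T]) (D [:: X w]).
by rewrite scale0r addr0.
Qed.

Lemma flow_mx_cvg us (t : R) p : nonzero p ->
  mcvg (nbhs p) (fun p => M us (t, p)) (M us (t, p)).
Proof.
move=> np; apply: mcvg_to_cplx.
have H := @iter_derive_flow_continuous _ _ _ _ flow us (t, p) np.
have c : (fun y => (t, y) : V) @ p --> ((t, p) : V).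
  have c1 : (fun=> t : R^o) @ p --> (t : R^o) by exact: cvg_cst.
  have c2 : (fun y : reals R r 1 => y) @ p --> p by exact: cvg_id.
  exact: (cvg_pair c1 c2).
exact: (cvg_comp _ _ c H).
Qed.

Lemma form_derivative_continuous (t : R) p v w : nonzero p ->
  {for p, continuous (fun p => form_derivative v w (t, p))}.
Proof.
move=> np; have c us : mcvg (nbhs p) (fun p => M us (t, p)) (M us (t, p)) by exact: flow_mx_cvg.
exact: (cvgD (cvgD (fubini_study_cvg (c _) (c _) (c _)) (fubini_study_cvg (c _) (c _) (c _)))
  (fubini_study_cvg (c _) (c _) (c _))).
Qed.

(** By [pullback_hamiltonian] and [pullback_form_derive], both sides are mixed second derivatives of
    [h t \o phi t]. *)
Lemma form_derivative_swap (t : R) p v w : 0 <= t <= 1 -> nonzero p ->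
  form_derivative v w (t, p) = form_derivative w v (t, p).
Proof.
move=> t01 np.
have nA : nbhs p (@nonzero R r) by apply: open_nbhs_nbhs; split => //; exact: open_nonzero.
pose K u p := fubini_study (M [::] (t, p)) (M [:: T] (t, p)) (M [:: X u] (t, p)).
apply: (@derive_swap R _ (homog (h t \o phi t)) (K w) (K v)
  (fun p => form_derivative w v (t, p)) (fun p => form_derivative v w (t, p))
  _ p w v nA (fun y Ay => pullback_hamiltonian flow w t01 Ay)
  (fun y Ay => pullback_hamiltonian flow v t01 Ay)
  (fun y Ay => pullback_form_derive t v w Ay)
  (fun y Ay => pullback_form_derive t w v Ay)
  (@form_derivative_continuous t p v w np) (@form_derivative_continuous t p w v np)).
Qed.

Lemma flow_mx_idem q : M [::] q *m M [::] q = M [::] q.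
Proof. exact: homog_embed_idem. Qed.

Lemma flow_symplectic_derive (t : R) p v w : 0 <= t <= 1 -> nonzero p ->
  is_derive t (1 : R)
    (fun s => fubini_study (M [::] (s, p)) (M [:: X v] (s, p)) (M [:: X w] (s, p))) 0.
Proof.
move=> t01 np; have D us := flow_mx_derive_time flow us t np.
apply: is_derive_eq (fubini_study_derive (D [::]) (D [:: X v]) (D [:: X w])) _.
have Aq : A (t, p) by [].
have swap a b := flow_mx_swap flow a b Aq.
have odd u := flow_mx_odd flow u Aq.
have adj us := flow_mx_adj flow us Aq.
have E := closed_form_derivative (flow_mx_idem (t, p)) (odd T) (odd (X v)) (odd (X w))
  (adj [::]) (adj [:: X v]) (adj [:: X w; T]) (swap (X v) (X w))
  (form_derivative_swap v w t01 np).
(* Differentiating the form in time puts [T] outermost, while the closedness relation has it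
   innermost. *)
by rewrite (swap T (X v)) (swap T (X w)).
Qed.

Lemma flow_symplectic p v w : nonzero p ->
  fubini_study (M [::] (1, p)) (M [:: X v] (1, p)) (M [:: X w] (1, p)) =
  fubini_study (M [::] (0, p)) (M [:: X v] (0, p)) (M [:: X w] (0, p)).
Proof.
move=> np; exact: (derive0_constant (fun s s01 => flow_symplectic_derive v w s01 np)).
Qed.

Lemma flow_mx0_mul (p : reals R r 1) : nonzero p ->
  M [::] (0, p) *m to_cplx p = to_cplx p.
Proof.
move=> np; have [L Lp] := nonzeroP np; rewrite (flow_mxE _ _ Lp).
have [_ _ -> _] := flow.
by rewrite projector_mul // Lp memv_line.
Qed.

(* Differentiating [P(p) p = p] gives [P_v p = v - P v]. *)
Lemma flow_mx0_tangent p v : nonzero p -> M [::] (0, p) *m to_cplx v = 0 ->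
  M [:: X v] (0, p) *m to_cplx p = to_cplx v.
Proof.
move=> np Pv.
have D := flow_mx_derive_space flow [::] 0 v np.
have L : is_mderive (fun s : R => to_cplx (p + s *: v)) 0 (to_cplx v).
  apply/is_mderive_to_cplx.
  have := is_derive_line (id : reals R r 1 -> reals R r 1) p v 0 v.
  by rewrite scale0r addr0 => -[H _]; apply: H; exact: is_derive_id.
have := is_mderiveM D L; rewrite scale0r addr0 Pv addr0 => H.
apply: is_mderive_unique H _; apply: near_is_mderive L.
have := near_line v (@open_nonzero R r) np.
by apply: filterS => s ns; rewrite flow_mx0_mul.
Qed.

Lemma flow_mx0_form p v w : nonzero p ->
  M [::] (0, p) *m to_cplx v = 0 -> M [::] (0, p) *m to_cplx w = 0 ->
  fubini_study (M [::] (0, p)) (M [:: X v] (0, p)) (M [:: X w] (0, p)) =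
  complex.Im ((((to_cplx p)^t* *m to_cplx p) 0 0)^-1
              * ((to_cplx v)^t* *m to_cplx w) 0 0).
Proof.
move=> np Pv Pw; have [L Lp] := nonzeroP np.
have P0 : M [::] (0, p) = outer (to_cplx p).
  rewrite (flow_mxE _ _ Lp); have [_ _ -> _] := flow; exact: projectorE.
have adj : (M [:: X v] (0, p))^t* = M [:: X v] (0, p) by exact: (flow_mx_adj flow).
exact: (fubini_study_outer P0 adj (flow_mx0_tangent np Pv) (flow_mx0_tangent np Pw)).
Qed.

End Symplectic.

(** * Frames moved by Hamiltonian diffeomorphisms *)

Lemma real_comb_to_cplx (R : realType) r m (v : 'cV[Cx R]_r) (D : reals R m m)
    (G : 'I_r + 'I_r -> reals R m m) :
  (forall i j, D.1 i j = \sum_k coord_val k (of_cplx v) * (G k).1 i j) ->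
  (forall i j, D.2 i j = \sum_k coord_val k (of_cplx v) * (G k).2 i j) ->
  to_cplx D = real_comb (fun k => to_cplx (G (inl k))) (fun k => to_cplx (G (inr k))) v.
Proof.
move=> E1 E2; apply/matrixP => i j; rewrite /real_comb summxE.
apply: cReIm_inj.
  rewrite to_cplx_re E1 big_sumType /= -big_split (big_morph _ (@cReD R) (erefl _)).
  by apply: eq_bigr => k _; rewrite /= !mxE cReD !cReM /= !mul0r !subr0.
rewrite to_cplx_im E2 big_sumType /= -big_split (big_morph _ (@cImD R) (erefl _)).
by apply: eq_bigr => k _; rewrite /= !mxE cImD !cImM /= !mul0r !addr0.
Qed.

Lemma is_mderive_conj (R : realType) n (X : R -> 'M[Cx R]_n) s dX (U W : 'M[Cx R]_n) :
  is_mderive X s dX -> is_mderive (fun t => U *m X t *m W) s (U *m dX *m W).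
Proof.
move=> H; have := is_mderiveM (is_mderiveM (is_mderive_cst U s) H) (is_mderive_cst W s).
by rewrite mul0mx add0r mulmx0 addr0.
Qed.

Lemma mulmx_conj_comb (K : comNzRingType) n (U W A B : 'M[K]_n) (i : K) :
  U *m A *m W - i *: (U *m B *m W) = U *m (A - i *: B) *m W.
Proof. by rewrite mulmxBr mulmxBl -scalemxAr -scalemxAl. Qed.

Lemma frame_mx_conj (R : realType) n (U W P : 'M[Cx R]_n.+1)
    (A B : 'I_n.+1 -> 'M[Cx R]_n.+1) m :
  frame_mx (U *m P *m W) (fun k => U *m A k *m W) (fun k => U *m B k *m W) m =
  U *m frame_mx P A B m *m W.
Proof. by rewrite /frame_mx; case: ifP => // _; exact: mulmx_conj_comb. Qed.

Section FlowLinear.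
Variables (R : realType) (r : nat).
Local Notation C := (Cx R).
Local Notation CP := (proj_space 'cV[C]_r).
Local Notation V := (time_space R r).
Variables (h : R -> CP -> R) (phi : R -> CP -> CP).
Hypothesis flow : hamiltonian_flow h phi.
Local Notation F := (flow_map phi).
Local Notation M := (flow_mx phi).
Local Notation X v := ((0, v) : V).

Lemma flow_mx_real_comb (t : R) p (v : 'cV[C]_r) : nonzero p ->
  M [:: X (of_cplx v)] (t, p) =
  real_comb (fun k => M [:: X (coord_dir R (inl k))] (t, p))
            (fun k => M [:: X (coord_dir R (inr k))] (t, p)) v.
Proof.
move=> np.
have nA : nbhs ((t, p) : V) (@flow_dom R r).
  by apply: open_nbhs_nbhs; split; [exact: open_flow_dom | exact: np].
have E1 i j : (iter_derive [:: X (of_cplx v)] F (t, p)).1 i j =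
    \sum_k coord_val k (of_cplx v) * (iter_derive [:: X (coord_dir R k)] F (t, p)).1 i j.
  rewrite coord_dir_time.
  apply: (@derive_sum_dir _ _ (fun q => (F q).1 i j)
    (fun u q => (iter_derive [:: u] F q).1 i j) _ _ _ _ _ _ nA) => [y u Ay|u].
    by have /is_derive_entries/(_ i j)[] := iter_derive_flow flow [::] u Ay.
  exact: continuous_entry1 (iter_derive_flow_continuous flow (np : @flow_dom R r (t, p))).
have E2 i j : (iter_derive [:: X (of_cplx v)] F (t, p)).2 i j =
    \sum_k coord_val k (of_cplx v) * (iter_derive [:: X (coord_dir R k)] F (t, p)).2 i j.
  rewrite coord_dir_time.
  apply: (@derive_sum_dir _ _ (fun q => (F q).2 i j)
    (fun u q => (iter_derive [:: u] F q).2 i j) _ _ _ _ _ _ nA) => [y u Ay|u].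
    by have /is_derive_entries/(_ i j)[] := iter_derive_flow flow [::] u Ay.
  exact: continuous_entry2 (iter_derive_flow_continuous flow (np : @flow_dom R r (t, p))).
exact: (real_comb_to_cplx E1 E2).
Qed.

End FlowLinear.

Section HamFrame.
Variables (R : realType) (n : nat).
Local Notation C := (Cx R).
Local Notation CP := (proj_space 'cV[C]_n.+1).
Local Notation embed := (@embed R n.+1).
Implicit Types psi : CP -> CP.

(** The first basis vector, so that its orthogonal complement is cut out by the vanishing of
    coordinate 0, the index that [frame_mx] treats apart. *)
Definition base_vector : 'cV[C]_n.+1 := delta_mx 0 0.
Definition base_point : reals R n.+1 1 := of_cplx base_vector.

Lemma base_point_nonzero : nonzero base_point.
Proof.
rewrite /nonzero /= of_cplxK; apply/eqP => /matrixP/(_ 0 0).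
by rewrite !mxE !eqxx => /eqP; rewrite oner_eq0.
Qed.

Definition base_line : CP := sval (cid (nonzeroP base_point_nonzero)).

Lemma base_lineE : sval base_line = <[to_cplx base_point]>%VS.
Proof. by rewrite /base_line; case: cid. Qed.

Definition point_mx psi : 'M[C]_n.+1 := to_cplx (homog (embed \o psi) base_point).
Definition diff_mx psi (v : reals R n.+1 1) : 'M[C]_n.+1 :=
  to_cplx ('D_v (homog (embed \o psi)) base_point).
Definition ham_frame_mx psi : 'I_n.+1 -> 'M[C]_n.+1 :=
  frame_mx (point_mx psi) (fun k => diff_mx psi (coord_dir R (inl k)))
    (fun k => diff_mx psi (coord_dir R (inr k))).

Lemma homog_embedE psi p (L : CP) : sval L = <[to_cplx p]>%VS ->
  to_cplx (homog (embed \o psi) p) = projector (psi L).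
Proof. by move=> Lp; rewrite (homogE _ Lp) /= of_cplxK. Qed.

Lemma homog_embed0 psi p : ~ nonzero p -> to_cplx (homog (embed \o psi) p) = 0.
Proof. by move=> n0; rewrite homog0 // to_cplx0. Qed.

Lemma point_mxE psi : point_mx psi = projector (psi base_line).
Proof. exact: (homog_embedE _ base_lineE). Qed.

Lemma flow_diff_mx h phi (v : reals R n.+1 1) : hamiltonian_flow h phi ->
  diff_mx (phi 1) v = flow_mx phi [:: ((0, v) : time_space R n.+1)] (1, base_point).
Proof.
move=> flow.
have [H _] := is_derive_snd (flow_map phi) 1 base_point v
  (iter_derive [:: ((0, v) : time_space R n.+1)] (flow_map phi) (1, base_point)).
have [_ E] := H (@iter_derive_flow _ _ _ _ flow [::] (1, base_point)
  ((0, v) : time_space R n.+1) base_point_nonzero).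
exact: (congr1 (@to_cplx R _ _) E).
Qed.

Lemma diff_mx_derive psi v : hamiltonian_diffeo psi ->
  is_mderive (fun s : R => to_cplx (homog (embed \o psi) (base_point + s *: v))) 0
    (diff_mx psi v).
Proof.
case=> h [phi [flow <-]]; rewrite (flow_diff_mx _ flow).
exact: (flow_mx_derive_space flow [::] 1 v base_point_nonzero).
Qed.

Lemma base_form_gt0 (v x y : 'cV[C]_n.+1) : v != 0 -> x = v ->
  y = (Complex 0 1 : C) *: v ->
  0 < complex.Im ((((to_cplx base_point)^t* *m to_cplx base_point) 0 0)^-1
    * (x^t* *m y) 0 0).
Proof.
move=> v0 -> ->; set N := (_ *m _) 0 0.
have N0 : 0 < N by rewrite lt0r sqmx_ge0 sqmx_eq0 base_point_nonzero.
have q0 : 0 < (v^t* *m v) 0 0 by rewrite lt0r sqmx_ge0 sqmx_eq0 v0.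
have -> : (v^t* *m ((Complex 0 1 : C) *: v)) 0 0 = (Complex 0 1 : C) * (v^t* *m v) 0 0.
  by rewrite -scalemxAr mxE.
rewrite mulrCA; have : 0 < N^-1 * (v^t* *m v) 0 0 by rewrite mulr_gt0 ?invr_gt0.
move: (_ * _) => q; rewrite ltcE /= => /andP[_ q1].
by rewrite cImM /= mul0r mul1r add0r.
Qed.

(** [flow_symplectic] carries the positivity of omega(v, i v) from the base point to its image,
    which is what [frame_mx_free] asks for. *)
Lemma ham_frame_mx_free psi (z : 'cV[C]_n.+1) (c : 'I_n.+1 -> C) :
  hamiltonian_diffeo psi -> sval (psi base_line) = <[z]>%VS ->
  \sum_m c m *: (ham_frame_mx psi m *m z) = 0 -> forall m, c m = 0.
Proof.
case=> h [phi [flow <-]] Lz.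
have z0 := nonzero_line Lz.
have np := base_point_nonzero.
have Pz : point_mx (phi 1) = outer z by rewrite point_mxE; exact: projectorE.
have XE (v : 'cV[C]_n.+1) :
  real_comb (fun k => diff_mx (phi 1) (coord_dir R (inl k)))
            (fun k => diff_mx (phi 1) (coord_dir R (inr k))) v =
  flow_mx phi [:: ((0, of_cplx v) : time_space R n.+1)] (1, base_point).
  rewrite (flow_mx_real_comb flow 1 v np) /real_comb; apply: eq_bigr => k _.
  by rewrite !(flow_diff_mx _ flow).
rewrite /ham_frame_mx Pz; apply: frame_mx_free => // [v|v|v v0 vn].
- by rewrite XE; exact: (flow_mx_adj flow).
- by rewrite XE -Pz; exact: (flow_mx_odd flow).
rewrite !XE -Pz.
have P0 (u : 'cV[C]_n.+1) : u 0 0 = 0 ->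
    flow_mx phi [::] (0, base_point) *m to_cplx (of_cplx u) = 0.
  move=> u0; rewrite (flow_mxE _ _ base_lineE); have [_ _ -> _] := flow.
  rewrite (projectorE base_lineE) outer_mulr !of_cplxK.
  have -> : ((base_vector^t* *m u) 0 0) = 0.
    rewrite mxE big1 // => k _; rewrite adjE mxE andbT.
    by have [->|k0] := eqVneq k 0; rewrite ?u0 ?mulr0 // rmorph0 mul0r.
  by rewrite mulr0 scale0r.
have Iv0 : ((Complex 0 1 : C) *: v) 0 0 = 0 by rewrite mxE v0 mulr0.
have E := flow_symplectic flow (of_cplx v) (of_cplx ((Complex 0 1 : C) *: v)) np.
have {}E := etrans E (flow_mx0_form flow np (P0 _ v0) (P0 _ Iv0)).
exact: (eq_ind_r (fun x => 0 < x) (base_form_gt0 vn (of_cplxK _) (of_cplxK _)) E).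
Qed.

Lemma conj_homog psi chi (U : 'M[C]_n.+1) (p : reals R n.+1 1) :
  (forall L, projector (psi L) = U *m projector (chi L) *m U^t*) ->
  to_cplx (homog (embed \o psi) p) = U *m to_cplx (homog (embed \o chi) p) *m U^t*.
Proof.
move=> E; have [/nonzeroP[L Lp]|n0] := pselect (nonzero p).
  exact: (etrans (homog_embedE psi Lp) (etrans (E L)
    (congr1 (fun P => U *m P *m U^t*) (esym (homog_embedE chi Lp))))).
apply: (etrans (homog_embed0 psi n0)); apply/esym.
apply: (etrans (congr1 (fun P => U *m P *m U^t*) (homog_embed0 chi n0))).
by rewrite mulmx0 mul0mx.
Qed.

(** Multiplication by constant matrices on both sides is complex-linear, so it commutes with
    differentiation and with taking the complex-linear part. *)
Lemma ham_frame_mx_conj psi chi (U : 'M[C]_n.+1) m :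
  hamiltonian_diffeo psi -> hamiltonian_diffeo chi ->
  (forall L, projector (psi L) = U *m projector (chi L) *m U^t*) ->
  ham_frame_mx psi m = U *m ham_frame_mx chi m *m U^t*.
Proof.
move=> hp hc E.
have D v : diff_mx psi v = U *m diff_mx chi v *m U^t*.
  apply: is_mderive_unique (diff_mx_derive v hp) _.
  under eq_fun do rewrite (conj_homog _ E).
  exact: is_mderive_conj (diff_mx_derive v hc).
have P : point_mx psi = U *m point_mx chi *m U^t* by exact: conj_homog.
have DA : (fun k => diff_mx psi (coord_dir R (inl k))) =
    (fun k => U *m diff_mx chi (coord_dir R (inl k)) *m U^t*).
  by apply/funext => k; exact: D.
have DB : (fun k => diff_mx psi (coord_dir R (inr k))) =
    (fun k => U *m diff_mx chi (coord_dir R (inr k)) *m U^t*).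
  by apply/funext => k; exact: D.
exact: (etrans (f_equal3 (fun P A B => frame_mx P A B m) P DA DB) (frame_mx_conj _ _ _ _ _ m)).
Qed.

(** A single nonzero vector is a compact set, on which uniform convergence is convergence at that
    vector. *)
Lemma ham_jet_continuous (vs : seq (reals R n.+1 1)) :
  continuous (fun psi : Ham R n.+1 =>
    iter_derive vs (homog (embed \o sval psi)) base_point).
Proof.
move=> psi.
have H := @initial_continuous (Ham R n.+1) _ (@jets R n.+1) psi.
have H1 := cvg_comp _ _ H (@proj_continuous _ _ vs (jets psi)).
have cA : [set A | compact A /\ A `<=` @nonzero R n.+1] [set base_point].
  split; first exact: compact_set1.
  by move=> p ->; exact: base_point_nonzero.
have FF : Filter (proj vs x @[x --> jets x @[x --> psi]]).
  by apply: fmap_filter; apply: fmap_filter; exact: nbhs_filter.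
have [H2 _] := @fam_cvgP _ _ [set A | compact A /\ A `<=` @nonzero R n.+1] _ (jets psi vs) FF.
have := H2 H1 _ cA.
by rewrite (uniform_set1 _ _ FF).
Qed.

Lemma point_mx_cvg (g : Ham R n.+1) :
  mcvg (nbhs g) (fun g => point_mx (sval g)) (point_mx (sval g)).
Proof. apply: mcvg_to_cplx; exact: (@ham_jet_continuous [::] g). Qed.

Lemma ham_frame_mx_cvg (g : Ham R n.+1) m :
  mcvg (nbhs g) (fun g => ham_frame_mx (sval g) m) (ham_frame_mx (sval g) m).
Proof.
have D v : mcvg (nbhs g) (fun g => diff_mx (sval g) v) (diff_mx (sval g) v).
  apply: mcvg_to_cplx; exact: (@ham_jet_continuous [:: v] g).
have [->|m0] := eqVneq m ord0; first exact: point_mx_cvg.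
have E psi : ham_frame_mx psi m =
    diff_mx psi (coord_dir R (inl m)) + (- (Complex 0 1 : C)) *: diff_mx psi (coord_dir R (inr m)).
  by rewrite /ham_frame_mx /frame_mx (negPf m0) scaleNr.
rewrite E; have -> : (fun g : Ham R n.+1 => ham_frame_mx (sval g) m) =
  (fun g => diff_mx (sval g) (coord_dir R (inl m)) +
     (- (Complex 0 1 : C)) *: diff_mx (sval g) (coord_dir R (inr m))).
  by apply/funext => x; exact: E.
have Z := @mcvgZ R _ (nbhs g) (nbhs_filter g) _ _ (- (Complex 0 1 : C)) _ _
  (D (coord_dir R (inr m))).
exact: (@mcvgD R _ (nbhs g) (nbhs_filter g) _ _ _ _ _ _ (D (coord_dir R (inl m))) Z).
Qed.

End HamFrame.

(** * Global frames and line bundles *)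

Section InverseLimit.
Variables (R : realType) (T : Type) (F : set_system T).
Context {FF : Filter F}.
Local Notation C := (Cx R).

Lemma cvg_bigprod (I : Type) (r : seq I) (P : pred I) (f : I -> T -> C) (l : I -> C) :
  (forall i, P i -> f i @ F --> l i) ->
  (fun t => \prod_(i <- r | P i) f i t) @ F --> \prod_(i <- r | P i) l i.
Proof.
move=> fl; elim: r => [|i r IH].
  by rewrite big_nil; under eq_fun do rewrite big_nil; exact: cvg_cst.
rewrite big_cons; under eq_fun do rewrite big_cons.
by case: ifP => [/fl fi|_]; [exact: (cvgM fi IH) | exact: IH].
Qed.

Lemma mcvg_det n (X : T -> 'M[C]_n) L : mcvg F X L -> (fun t => \det (X t)) @ F --> \det L.
Proof.
move=> XL; apply: cvg_bigsum => s _; apply: cvgM; first exact: cvg_cst.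
by apply: cvg_bigprod => i _; exact: XL.
Qed.

(** Cramer's formula replaces [invmx] along the filter: [invmx] returns its argument on singular
    matrices, and the formula avoids that case distinction. *)
Lemma mcvg_invmx n (X : T -> 'M[C]_n) L : mcvg F X L -> L \in unitmx ->
  mcvg F (fun t => (\det (X t))^-1 *: \adj (X t)) (invmx L).
Proof.
move=> XL uL i j; rewrite /invmx uL mxE.
under eq_fun do rewrite mxE.
apply: cvgM.
  by apply: cvgV; [move: uL; rewrite unitmxE unitfE | exact: mcvg_det].
have adjE (A : 'M[C]_n) : \adj A i j = (-1) ^+ (j + i) * \det (row' j (col' i A)).
  by rewrite mxE.
rewrite adjE; under eq_fun do rewrite adjE.
apply: cvgM; first exact: cvg_cst.
apply: mcvg_det => k l; rewrite !mxE; under eq_fun do rewrite !mxE.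
exact: XL.
Qed.

End InverseLimit.

Lemma cvg_lincomb (K : numFieldType) (W : normedModType K) (T : Type)
    (F : set_system T) (FF : Filter F) (I : Type) (r : seq I)
    (a : I -> T -> K) (f : I -> T -> W) (l : I -> K) (w : I -> W) :
  (forall i, a i @ F --> l i) -> (forall i, f i @ F --> w i) ->
  (fun t => \sum_(i <- r) a i t *: f i t) @ F --> \sum_(i <- r) l i *: w i.
Proof.
move=> al fw; elim: r => [|i r IH].
  by rewrite big_nil; under eq_fun do rewrite big_nil; exact: cvg_cst.
rewrite big_cons; under eq_fun do rewrite big_cons.
exact: (cvgD (cvgZ (al i) (fw i)) IH).
Qed.

Section Within.
Variables (R : realType) (B : topologicalType).
Local Notation C := (Cx R).

Lemma open_within_neq0 (D : set B) (f : B -> C) :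
  open D -> {within D, continuous f} -> open (D `&` [set b | f b != 0]).
Proof.
move=> oD fc; rewrite openE => b [Db fb]; rewrite /interior.
have nD : nbhs b D by apply: open_nbhs_nbhs.
have fb' : f @ b --> f b by move: fc; rewrite continuous_open_subspace //; apply; rewrite inE.
have n0 : nbhs (f b) [set x : C | x != 0].
  apply: open_nbhs_nbhs; split => //.
  have -> : [set x : C | x != 0] = ~` [set 0] by apply/seteqP; split => x /eqP.
  by apply/closed_openC/accessible_closed_set1/hausdorff_accessible/norm_hausdorff.
exact: filterI nD (fb' _ n0).
Qed.

Lemma within_local (W : topologicalType) (f : B -> W) (I : Type) (D : I -> set B) :
  (forall i, open (D i)) -> (forall b, exists i, D i b) ->
  (forall i, {within D i, continuous f}) -> continuous f.
Proof.
move=> oD cD fc b; have [i ib] := cD b.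
have := fc i; rewrite continuous_open_subspace //.
by apply; rewrite inE.
Qed.

End Within.

(** * Bundles with a continuous global frame *)

Section GlobalFrame.
Variables (R : realType) (H : hilbert R) (B : topologicalType) (r : nat).
Local Notation C := (Cx R).
Variables (V : vbundle R B r) (sigma : forall b, r.-tuple (V b)).
Hypothesis basis_sigma : forall b, basis_of fullv (sigma b).
Hypothesis continuous_sigma : forall (i : at_index (vb_atlas V)) (k m : 'I_r),
  {within at_dom i, continuous (fun b => coord (at_frame i b) k (sigma b)`_m)}.

Lemma frame_map_bij b : bijective (frame_map (sigma b)).
Proof.
exists (fun x => \col_m coord (sigma b) m x) => [z|x].
  apply/matrixP => m j; rewrite mxE ord1.
  exact: (coord_sum_free (z ^~ 0) m (basis_free (basis_sigma b))).
rewrite /frame_map [RHS](coord_basis (basis_sigma b) (memvf x)).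
by apply: eq_bigr => m _; rewrite mxE.
Qed.

Lemma frame_map_std b (m : 'I_r) : frame_map (sigma b) (std_frame R r)`_m = (sigma b)`_m.
Proof.
rewrite -tnth_nth tnth_mktuple /frame_map (bigD1 m) //= mxE !eqxx scale1r big1 ?addr0 //.
by move=> k km; rewrite mxE (negPf km) scale0r.
Qed.

Definition coords_map b (x : V b) : 'cV[C]_r := \col_m coord (sigma b) m x.

Fact coords_map_linear b : linear (@coords_map b).
Proof. by move=> a x y; apply/matrixP => m j; rewrite !mxE linearP. Qed.

HB.instance Definition _ b := GRing.isLinear.Build C (V b) 'cV[C]_r *:%R
  (@coords_map b) (@coords_map_linear b).

Lemma coord_change b (x y : r.-tuple (V b)) : basis_of fullv x -> basis_of fullv y ->
  (\matrix_(k < r, m < r) coord x k y`_m) *m (\matrix_(m < r, l < r) coord y m x`_l) = 1%:M.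
Proof.
move=> bx byy; apply/matrixP => k l; rewrite !mxE.
under eq_bigr do rewrite !mxE.
transitivity (coord x k x`_l); last by rewrite (coord_free _ _ (basis_free bx)) eq_sym.
rewrite [X in _ = coord x k X](coord_basis byy (memvf x`_l)) linear_sum.
by apply: eq_bigr => m _; rewrite linearZ /= mulrC.
Qed.

(** Composing a classifying map with the fibrewise isomorphism given by [sigma] does not change its
    ranges, so the same family [f] represents both bundles. *)
Lemma represents_to_trivial (f : B -> Fred H) :
  represents V f -> represents (trivial_vbundle R B r) f.
Proof.
case=> cf sf [c [[inj_c cont_c] range_c]]; split=> //.
exists (fun b => c b \o frame_map (sigma b) : {linear 'cV[C]_r -> H}); split; last first.
  move=> b; rewrite -range_c; apply/seteqP; split => [_ [z _ <-]|_ [x _ <-]] /=.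
    by exists (frame_map (sigma b) z).
  have [g _ fgK] := frame_map_bij b.
  by exists (g x) => //=; rewrite fgK.
split=> [b|i k]; first by apply: inj_comp; [exact: inj_c | exact: bij_inj (frame_map_bij b)].
apply: continuous_subspaceT.
have -> : (fun b => (c b \o frame_map (sigma b)) (at_frame i b)`_k) =
    (fun b => c b (sigma b)`_k).
  by apply/funext => b /=; rewrite frame_map_std.
apply: (@within_local _ _ _ (at_index (vb_atlas V)) (fun i => at_dom i)) => [j|b|j].
- exact: at_open.
- exact: at_cover.
apply: (@subspace_eq_continuous _ (at_dom j) _
    (fun b => \sum_l coord (at_frame j b) l (sigma b)`_k *: c b (at_frame j b)`_l)).
  move=> b; rewrite inE => jb.
  transitivity (c b (sigma b)`_k) => //.
  rewrite [X in _ = c b X](coord_basis (at_basis jb) (memvf (sigma b)`_k)) linear_sum.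
  by apply: eq_bigr => l _; rewrite linearZ.
by move=> b; apply: cvg_lincomb => l; [exact: continuous_sigma | exact: cont_c].
Qed.

Lemma represents_of_trivial (f : B -> Fred H) :
  represents (trivial_vbundle R B r) f -> represents V f.
Proof.
case=> cf sf [c [[inj_c cont_c] range_c]]; split=> //.
exists (fun b => c b \o @coords_map b : {linear V b -> H}).
have cm b x : @coords_map b (frame_map (sigma b) x) = x.
  apply/matrixP => m j; rewrite mxE ord1.
  exact: (coord_sum_free (x ^~ 0) m (basis_free (basis_sigma b))).
split; last first.
  move=> b; rewrite -range_c; apply/seteqP; split => [_ [z _ <-]|_ [x _ <-]] /=.
    by exists (coords_map z).
  by exists (frame_map (sigma b) x) => //=; rewrite cm.
split=> [b x y /= /inj_c xy|j l].
  rewrite (coord_basis (basis_sigma b) (memvf x)) (coord_basis (basis_sigma b) (memvf y)).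
  apply: eq_bigr => m _; congr (_ *: _).
  by have /matrixP/(_ m 0) := xy; rewrite !mxE.
(* Continuity is known for the coordinates of [sigma] in the local frame; here the inverse matrix is
   needed, whence the adjugate formula. *)
pose S b : 'M[C]_r := \matrix_(k < r, m < r) coord (at_frame j b) k (sigma b)`_m.
apply: (@subspace_eq_continuous _ (at_dom j) _
    (fun b => \sum_m ((\det (S b))^-1 *: \adj (S b)) m l *: c b (std_frame R r)`_m)).
  move=> b; rewrite inE => jb.
  have SN := coord_change (at_basis jb) (basis_sigma b).
  have uS : S b \in unitmx by case: (mulmx1_unit SN).
  have -> : (\det (S b))^-1 *: \adj (S b) = invmx (S b) by rewrite /invmx uS.
  have -> : invmx (S b) = \matrix_(m < r, l < r) coord (sigma b) m (at_frame j b)`_l.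
    by rewrite -[RHS](mulKmx uS) SN mulmx1.
  have E : coords_map (at_frame j b)`_l =
      \sum_m coord (sigma b) m (at_frame j b)`_l *: (std_frame R r)`_m.
    have stdE (k : 'I_r) : (std_frame R r)`_k = delta_mx k 0 :> 'cV[C]_r.
      by rewrite -tnth_nth tnth_mktuple.
    under eq_bigr do rewrite stdE.
    apply/matrixP => m i; rewrite ord1 summxE mxE (bigD1 m) //= big1 => [|k km].
      by rewrite !mxE !eqxx mulr1 addr0.
    by rewrite !mxE eq_sym (negPf km) mulr0.
  transitivity (c b (coords_map (at_frame j b)`_l)) => //.
  by rewrite E linear_sum; apply: eq_bigr => m _; rewrite mxE linearZ.
rewrite continuous_subspace_in => b; rewrite inE => jb.
have uS : S b \in unitmx.
  by have /mulmx1_unit[] := coord_change (at_basis jb) (basis_sigma b).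
have cS : mcvg (nbhs (b : subspace (at_dom j))) S (S b).
  move=> k m; rewrite mxE; under eq_fun do rewrite mxE.
  exact: continuous_sigma.
have cI := mcvg_invmx cS uS.
have E : (\det (S b))^-1 *: \adj (S b) = invmx (S b) by rewrite /invmx uS.
rewrite /continuous_at E; apply: cvg_lincomb => m; first exact: cI.
have c0 : continuous (fun b => c b (std_frame R r)`_m).
  apply: (@within_local _ _ _ unit (fun=> setT)) => [_|x|_]; [exact: openT | by exists tt |].
  exact: (cont_c tt m).
exact: (continuous_subspaceT c0).
Qed.

Lemma K0_class_global_frame :
  K0_class H V = K0_class H (trivial_vbundle R B r).
Proof.
apply/seteqP; split=> g [f rf fg]; exists f => //.
  exact: represents_to_trivial.
exact: represents_of_trivial.
Qed.

End GlobalFrame.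

Lemma cvg_conj (R : realType) (T : Type) (F : set_system T) (FF : Filter F)
    (f : T -> Cx R) (l : Cx R) : f @ F --> l -> (fun t => (f t)^*) @ F --> l^*.
Proof.
move=> fl; apply/cvgrPdist_lt => e e0.
have := fl; move/cvgrPdist_lt => /(_ e e0); apply: filterS => t.
by rewrite -rmorphB norm_conjC.
Qed.

(** * The dual of the line spanned by a section with discontinuous phase *)

Section LineBundle.
Variables (R : realType) (B : topologicalType) (r : nat).
Local Notation C := (Cx R).
Variables (E : vbundle R B r) (Q : unitary_reduction E) (z : forall b, E b).

Definition frame_coords (j : at_index Q) b (x : E b) : 'cV[C]_r :=
  \col_k coord (at_frame j b) k x.
Local Notation y j b := (frame_coords j (z b)).

Hypothesis z_unit : forall (j : at_index Q) b, at_dom j b ->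
  ((y j b)^t* *m y j b) 0 0 = 1.
(** Continuity of the projector onto the line of [z b], which does not see the phase of [z b]. *)
Hypothesis z_continuous : forall (j : at_index Q) k l,
  {within at_dom j, continuous (fun b => y j b k 0 * (y j b l 0)^*)}.

Lemma line_basis (a : C) : a != 0 -> basis_of fullv ([tuple a] : 1.-tuple (C^o : vectType C)).
Proof.
by move=> a0; rewrite basisEfree subvf seq1_free a0 dimvf.
Qed.

Lemma coord_line (a : C) (x : C^o) k : a != 0 ->
  coord ([tuple a] : 1.-tuple (C^o : vectType C)) k x = x / a.
Proof.
move=> a0; have f := basis_free (line_basis a0).
have -> : x = (x / a) *: ([tuple a] : 1.-tuple (C^o : vectType C))`_k.
  by rewrite ord1 /=; rewrite /GRing.scale /= divfK.
rewrite linearZ /= (coord_free _ _ f) eqxx /GRing.scale /= mulr1.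
by rewrite ord1 /= divfK.
Qed.

(** Where this coordinate is nonzero, multiplying [z b] by its conjugate removes the ambiguity of
    phase. *)
Definition line_dom (i : at_index Q * 'I_r) : set B :=
  at_dom i.1 `&` [set b | y i.1 b i.2 0 != 0].

(* The fiber of the dual of the line spanned by [z b], identified with [C] by
   evaluation at [z b]; the frame is dual to the local section
   [conj (y j b l 0) *: z b]. *)
Definition line_frame (i : at_index Q * 'I_r) b : 1.-tuple (C^o : vectType C) :=
  [tuple ((y i.1 b i.2 0)^*)^-1].

Lemma frame_coords_change (i j : at_index Q) b k : at_dom j b ->
  y i b k 0 = \sum_(q < r) coord (at_frame i b) k (at_frame j b)`_q * y j b q 0.
Proof.
move=> jb; rewrite mxE {1}(coord_basis (at_basis jb) (memvf (z b))) linear_sum.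
by apply: eq_bigr => q _; rewrite linearZ /= mulrC mxE.
Qed.

Definition line_atlas : atlas (fun _ : B => C^o : vectType C) 1.
Proof.
exists (at_index Q * 'I_r)%type line_dom line_frame.
(* The coordinate itself may be discontinuous, but its squared modulus is an entry of the
   projector. *)
- move=> i; have -> : line_dom i = at_dom i.1 `&`
      [set b | y i.1 b i.2 0 * (y i.1 b i.2 0)^* != 0].
    by apply/seteqP; split => b [ib nb]; split => //; move: nb; rewrite /= mulf_eq0 conjC_eq0 orbb.
  by apply: open_within_neq0; [exact: at_open | exact: z_continuous].
- move=> b; have [j jb] := at_cover Q b.
  have [k yk] : exists k, y j b k 0 != 0.
    apply: contrapT => nk; have := z_unit jb; rewrite mxE big1 => [/esym/eqP|k _].
      by rewrite oner_eq0.
    have [->|yk] := eqVneq (y j b k 0) 0; first by rewrite mulr0.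
    by case: nk; exists k.
  by exists (j, k).
- by move=> i b [_ nb]; apply: line_basis; rewrite invr_eq0 conjC_eq0.
- move=> i j k l.
  (* The transition function conj(y_i) / conj(y_j), expanded by y_j. Writing the coordinates in
     frame [i.1] through frame [j.1] leaves only entries of the projector and of the change of
     frame. *)
  pose g b : C := (\sum_(q < r) coord (at_frame i.1 b) i.2 (at_frame j.1 b)`_q *
     (y j.1 b q 0 * (y j.1 b j.2 0)^*))^* / (y j.1 b j.2 0 * (y j.1 b j.2 0)^*).
  apply: (@subspace_eq_continuous _ _ _ g).
    move=> b; rewrite inE => -[[ib ni] [jb nj]].
    transitivity (coord (line_frame i b) k ((line_frame j b)`_l : C^o)) => //.
    rewrite coord_line ?invr_eq0 ?conjC_eq0 // ord1 /= invrK /g.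
    under eq_bigr do rewrite mulrA.
    rewrite -mulr_suml -frame_coords_change // rmorphM /= conjCK.
    by field; rewrite conjC_eq0 nj.
  have sub : line_dom i `&` line_dom j `<=` at_dom i.1 `&` at_dom j.1 by move=> b [[? _] [? _]].
  have subj : line_dom i `&` line_dom j `<=` at_dom j.1 by move=> b [_ [? _]].
  have cz q l' := continuous_subspaceW subj (@z_continuous j.1 q l').
  rewrite continuous_subspace_in => b; rewrite inE => -[_ [jb nj]].
  apply: cvgM.
    apply: cvg_conj; apply: cvg_bigsum => q _; apply: cvgM.
      exact: (continuous_subspaceW sub (@at_continuous _ _ _ _ Q i.1 j.1 i.2 q)).
    exact: cz.
  by apply: cvgV; [rewrite mulf_neq0 ?conjC_eq0 | exact: cz].
Defined.

Definition line_vbundle : vbundle R B 1 := VBundle line_atlas.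

Variables (H : hilbert R) (w : forall b, r.-tuple (E b)).
Hypothesis w_basis : forall b, basis_of fullv (w b).
(** In the application [w b] is linear in [z b], and the conjugate coordinate cancels the common
    phase. *)
Hypothesis w_continuous : forall (j : at_index Q) (m k l : 'I_r),
  {within at_dom j, continuous
    (fun b => coord (at_frame j b) k (w b)`_m * (y j b l 0)^*)}.

(** The global frame of the tensor product consists of the [w] tensored with 1, the functional with
    value 1 at [z b]. In the frame ([j], [l]) that functional has coordinate conj([y j b l 0]), so
    [w_continuous] is the continuity required. *)
Lemma K0_class_line_trivial :
  K0_class H (tensor_vbundle E line_vbundle) = K0_class H (trivial_vbundle R B r).
Proof.
have n1 : (1 : C) != 0 by exact: oner_neq0.
pose one : 1.-tuple (C^o : vectType C) := [tuple 1].
apply: (@K0_class_global_frame R H B r (tensor_vbundle E line_vbundle)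
  (fun b => tensor_frame (w b) one`_0)) => [b|[a [j l]] k m].
  by apply: tensor_frame_basis; [exact: w_basis | exact: line_basis].
pose g b : C := \sum_(q < r) coord (at_frame a b) k (at_frame j b)`_q *
  (coord (at_frame j b) q (w b)`_m * (y j b l 0)^*).
apply: (@subspace_eq_continuous _ _ _ g).
  move=> b; rewrite inE => -[ab [jb nj]].
  transitivity (coord (tensor_frame (at_frame a b) (line_frame (j, l) b)`_0) k
    (tensor_frame (w b) one`_0)`_m) => //.
  have bu : basis_of fullv (line_frame (j, l) b) by apply: line_basis; rewrite invr_eq0 conjC_eq0.
  rewrite (coord_tensor_frame _ _ _ _ (at_basis ab) bu).
  rewrite coord_line ?invr_eq0 ?conjC_eq0 // invrK mul1r.
  rewrite [X in _ = coord _ k X * _](coord_basis (at_basis jb) (memvf (w b)`_m)).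
  rewrite linear_sum mulr_suml.
  by apply: eq_bigr => q _; rewrite linearZ /= mulrA [_ * coord _ q _]mulrC.
have sub1 : at_dom a `&` line_dom (j, l) `<=` at_dom a `&` at_dom j by move=> b [? [? _]].
have sub2 : at_dom a `&` line_dom (j, l) `<=` at_dom j by move=> b [_ [? _]].
move=> b; apply: cvg_bigsum => q _; apply: cvgM.
  exact: (continuous_subspaceW sub1 (@ur_compatible _ _ _ _ Q a j k q)).
exact: (continuous_subspaceW sub2 (@w_continuous j m q l)).
Qed.

End LineBundle.

(** * The trivializing line bundle *)

Section FrameChange.
Variables (K : fieldType) (r : nat) (V : vectType K) (x y : r.-tuple V).
Hypotheses (bx : basis_of fullv x) (byy : basis_of fullv y).

Definition change_mx : 'M[K]_r := \matrix_(k < r, l < r) coord x k y`_l.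

Lemma coord_frame_map (v : 'cV[K]_r) :
  \col_k coord x k (frame_map y v) = change_mx *m v.
Proof.
apply/matrixP => k j; rewrite !mxE linear_sum ord1; apply: eq_bigr => l _.
by rewrite linearZ /= mxE mulrC.
Qed.

Lemma frame_map_change (v : 'cV[K]_r) : frame_map y v = frame_map x (change_mx *m v).
Proof.
rewrite -coord_frame_map {1}(coord_basis bx (memvf (frame_map y v))).
by apply: eq_bigr => k _; rewrite mxE.
Qed.

Lemma frame_line_change (L M : proj_space 'cV[K]_r) (v : 'cV[K]_r) :
  frame_line bx L = frame_line byy M -> sval M = <[v]>%VS ->
  sval L = <[change_mx *m v]>%VS.
Proof.
move=> /(congr1 val) /= LM Mv; apply/eqP.
rewrite -(eq_limg_ker0 _ _ (frame_hom_ker bx)) LM Mv !limg_line !lfunE /=.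
by rewrite frame_map_change.
Qed.

Lemma frame_map_inj : injective (frame_map x).
Proof.
move=> u v uv; have /lker0P := frame_hom_ker bx; apply.
by rewrite !lfunE.
Qed.

Lemma frame_map_basis (u : 'I_r -> 'cV[K]_r) :
  (forall c : 'I_r -> K, \sum_m c m *: u m = 0 -> forall m, c m = 0) ->
  basis_of fullv [tuple frame_map x (u m) | m < r].
Proof.
move=> free_u; rewrite basisEfree subvf size_tuple (size_basis bx) leqnn !andbT.
apply/freeP => c E; apply: free_u; apply: frame_map_inj.
rewrite linear0 linear_sum -[RHS]E; apply: eq_bigr => m _.
by rewrite -tnth_nth tnth_mktuple linearZ.
Qed.

End FrameChange.

Lemma exists_unit (R : realType) r (L : proj_space 'cV[Cx R]_r) :
  exists2 e : 'cV[Cx R]_r, sval L = <[e]>%VS & (e^t* *m e) 0 0 = 1.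
Proof.
pose v := vpick (sval L); pose N := (v^t* *m v) 0 0.
have v0 : v != 0 by rewrite vpick0 -dimv_eq0 (eqP (svalP L)).
have s0 : sqrtC N != 0 by rewrite sqrtC_eq0 sqmx_eq0.
exists ((sqrtC N)^-1 *: v).
  apply/esym/eqP; rewrite eqEdim (eqP (svalP L)) dim_vline scaler_eq0 invr_eq0.
  by rewrite (negPf s0) (negPf v0) leqnn andbT -memvE memvZ // memv_pick.
transitivity (((sqrtC N)^-1)^* * (sqrtC N)^-1 * N).
  by rewrite adjZ -scalemxAl -scalemxAr scalerA mxE.
have -> : ((sqrtC N)^-1)^* = (sqrtC N)^-1.
  by apply/CrealP; rewrite rpredV ger0_real // sqrtC_ge0 sqmx_ge0.
by rewrite -[X in _ * X]sqrtCK; field.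
Qed.

(** The empty tuple is a basis of each fiber, hence a global frame. *)
Lemma K0_class_rank0 (R : realType) (H : hilbert R) (B : topologicalType) (V : vbundle R B 0) :
  K0_class H V = K0_class H (trivial_vbundle R B 0).
Proof.
apply: (@K0_class_global_frame R H B 0 V (fun b => [tuple])) => [b|i [] //].
have [i ib] := at_cover (vb_atlas V) b.
by have := at_basis ib; rewrite (tuple0 (at_frame i b)).
Qed.

Section Trivialization.
Variables (R : realType) (H : hilbert R) (B : topologicalType) (n : nat).
Local Notation C := (Cx R).
Local Notation CP := (proj_space 'cV[C]_n.+1).
Variables (E : vbundle R B n.+1) (Q : unitary_reduction E).
Variables (triv : forall b, CP -> proj_space (E b)) (g : at_index Q -> B -> Ham R n.+1).
Hypothesis g_continuous : forall j, {within at_dom j, continuous (g j)}.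
Hypothesis g_triv : forall j b (jb : at_dom j b) x,
  triv b x = frame_line (at_basis jb) (sval (g j b) x).

(** A chart is chosen at each point with no regularity in [b]. The vectors [z b] and [w b] are built
    in this chart, and continuity is checked after reading them in a fixed chart. *)
Let j0 b : at_index Q := sval (cid (at_cover Q b)).
Let j0P b : at_dom (j0 b) b := svalP (cid (at_cover Q b)).
Let psi b := sval (g (j0 b) b).
Let e b : 'cV[C]_n.+1 := s2val (cid2 (exists_unit (psi b (base_line R n)))).

Lemma chosen_line b : sval (psi b (base_line R n)) = <[e b]>%VS.
Proof. exact: s2valP (cid2 (exists_unit _)). Qed.

Lemma chosen_unit b : ((e b)^t* *m e b) 0 0 = 1.
Proof. exact: s2valP' (cid2 (exists_unit _)). Qed.

Let z b : E b := frame_map (at_frame (j0 b) b) (e b).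
Let w b : n.+1.-tuple (E b) :=
  [tuple frame_map (at_frame (j0 b) b) (ham_frame_mx (psi b) m *m e b) | m < n.+1].
Let A (j : at_index Q) b : 'M[C]_n.+1 := change_mx (at_frame j b) (at_frame (j0 b) b).

Lemma change_unitary (j : at_index Q) b : at_dom j b -> A j b \is unitarymx.
Proof. by move=> jb; exact: (ur_unitary jb (j0P b)). Qed.

Lemma z_coords (j : at_index Q) b : frame_coords j (z b) = A j b *m e b.
Proof. exact: coord_frame_map. Qed.

(** Both charts describe the same line of [E b], and the change of frame between them is unitary. *)
Lemma projector_change (j : at_index Q) b : at_dom j b -> forall x,
  projector (sval (g j b) x) = A j b *m projector (psi b x) *m (A j b)^t*.
Proof.
move=> jb x; have [v xv _] := exists_unit (psi b x).
have Lj := frame_line_change (etrans (esym (g_triv jb x)) (g_triv (j0P b) x)) xv.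
by rewrite (projectorE Lj) (projectorE xv) outer_unitary // change_unitary.
Qed.

Lemma outer_unit (u : 'cV[C]_n.+1) : (u^t* *m u) 0 0 = 1 -> outer u = u *m u^t*.
Proof. by rewrite /outer => ->; rewrite invr1 scale1r. Qed.

Lemma z_coords_unit (j : at_index Q) b : at_dom j b ->
  ((frame_coords j (z b))^t* *m frame_coords j (z b)) 0 0 = 1.
Proof.
move=> jb; have /unitarymxP AA := change_unitary jb.
by rewrite z_coords adjM mulmxA -(mulmxA ((e b)^t*)) (mulmx1C AA) mulmx1 chosen_unit.
Qed.

Lemma point_mx_coords (j : at_index Q) b : at_dom j b ->
  point_mx (sval (g j b)) = frame_coords j (z b) *m (frame_coords j (z b))^t*.
Proof.
move=> jb; rewrite -outer_unit ?z_coords_unit // z_coords outer_unitary ?change_unitary //.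
by rewrite point_mxE (projector_change jb) (projectorE (chosen_line b)).
Qed.

(** By equivariance, the chosen chart [j0 b] disappears from the formula: in any chart the frame is
    the one of that chart's own Hamiltonian diffeomorphism, applied to [z b]. *)
Lemma w_coords (j : at_index Q) b (m : 'I_n.+1) : at_dom j b ->
  frame_coords j (w b)`_m = ham_frame_mx (sval (g j b)) m *m frame_coords j (z b).
Proof.
move=> jb; have /unitarymxP AA := change_unitary jb.
rewrite -tnth_nth tnth_mktuple z_coords.
rewrite (ham_frame_mx_conj m (svalP (g j b)) (svalP (g (j0 b) b)) (projector_change jb)).
rewrite -mulmxA (mulmxA _ (A j b)) (mulmx1C AA) mul1mx -mulmxA.
exact: coord_frame_map.
Qed.

Lemma within_ham_mcvg (j : at_index Q) b (F : Ham R n.+1 -> 'M[C]_n.+1) :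
  (forall psi : Ham R n.+1, mcvg (nbhs psi) F (F psi)) ->
  mcvg (nbhs (b : subspace (at_dom j))) (fun b => F (g j b)) (F (g j b)).
Proof.
move=> cF k l; exact: (cvg_comp _ _ (@g_continuous j b) (cF (g j b) k l)).
Qed.

Lemma ham_trivial_K0 : exists U : vbundle R B 1,
  K0_class H (tensor_vbundle E U) = K0_class H (trivial_vbundle R B n.+1).
Proof.
have zc (j : at_index Q) k l : {within at_dom j, continuous (fun b =>
    frame_coords j (z b) k 0 * (frame_coords j (z b) l 0)^*)}.
  apply: (@subspace_eq_continuous _ (at_dom j) _ (fun b => point_mx (sval (g j b)) k l)).
    move=> b; rewrite inE => jb; rewrite point_mx_coords //.
    by rewrite mxE big_ord1 adjE.
  by move=> b; apply: (within_ham_mcvg (F := fun psi => point_mx (sval psi))) => psi';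
    exact: point_mx_cvg.
exists (line_vbundle z_coords_unit zc).
apply: (@K0_class_line_trivial _ _ _ _ _ _ _ _ _ w) => [b|j m k l].
  apply: (frame_map_basis (at_basis (j0P b))) => c.
  exact: (ham_frame_mx_free (svalP (g (j0 b) b)) (chosen_line b)).
(* Read in chart [j], the vector w_m times the adjoint of z is the frame matrix times the projector,
   both continuous functions of [g j b]. *)
apply: (@subspace_eq_continuous _ (at_dom j) _
   (fun b => (ham_frame_mx (sval (g j b)) m *m point_mx (sval (g j b))) k l)).
  move=> b; rewrite inE => jb; rewrite point_mx_coords // mulmxA -w_coords //.
  by rewrite mxE big_ord1 adjE [frame_coords _ _ k 0]mxE.
move=> b; apply: (within_ham_mcvg
  (F := fun psi => ham_frame_mx (sval psi) m *m point_mx (sval psi))).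
by move=> psi'; apply: mcvgM; [exact: ham_frame_mx_cvg | exact: point_mx_cvg].
Qed.

End Trivialization.

Theorem theorem1p2 (R : realType) (H : hilbert R)
    (B : topologicalType) (r : nat) (E : vbundle R B r)
    (Q : unitary_reduction E) :
  separable H -> infinite_dimensional H ->
  paracompact B -> hausdorff_space B ->
  (forall U : vbundle R B 1,
     K0_class H (tensor_vbundle E U) <> K0_class H (trivial_vbundle R B r)) ->
  ~ ham_isomorphic (projectivization Q)
      (trivial_fbundle B (proj_space 'cV[Cx R]_r)).
Proof.
move=> _ _ _ _ nontrivial [_ [triv [_ _ _ map_triv]]].
case: r E Q nontrivial triv map_triv => [|n] E Q nontrivial triv map_triv.
  (* In rank 0 the projective spaces are empty and carry no information; the hypothesis fails
     already for the trivial line bundle, since every bundle of rank 0 has the trivial class. *)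
  exact: (nontrivial (trivial_vbundle R B 1) (K0_class_rank0 H _)).
(* The index [tt] is the only chart of the trivial bundle, so each chart of P(E) receives one
   continuous map to the Hamiltonian group. *)
have /choice[g gP] := map_triv tt.
have gc j : {within at_dom j, continuous (g j)}.
  by have [] := gP j; rewrite setTI.
have [U /nontrivial] := @ham_trivial_K0 R H B n E Q triv g gc
  (fun j b jb x => (gP j).2 b I jb x).
by [].
Qed.
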